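(* Let $(X,\mu)$ be a probability space, let $T\colon X\to X$ be an ergodic ($\mu$-preserving) transformation, and let $A\colon X\to \mathrm{SL}(2,\mathbb{R})$ be a measurable function with $\int_X \log\|A\|\,d\mu<\infty$. Then $$ \frac{1}{2\pi}\int_{0}^{2\pi} \lambda^{+}(AR_{\theta})\, d\theta = \int_{X}\log\left( \frac{\|A(x)\|+\|A(x)\|^{-1}}{2} \right) d\mu(x). $$
   Context: $\mathrm{SL}(2,\mathbb{R})$ is the group of real $2\times 2$ matrices of determinant $1$; $\|\cdot\|$ is the operator norm with respect to the Euclidean norm. For $\theta\in\mathbb{R}$, $R_\theta=\begin{pmatrix}\cos\theta & -\sin\theta\\ \sin\theta & \cos\theta\end{pmatrix}$, and $AR_\theta\colon X\to \mathrm{SL}(2,\mathbb{R})$ is defined by $(AR_\theta)(x)=A(x)R_\theta$. For a measurable $A\colon X\to\mathrm{SL}(2,\mathbb{R})$ with $\int\log\|A\|\,d\mu<\infty$, write $A^n(x)=A(T^{n-1}x)\cdots A(Tx)A(x)$ for $x\in X$, $n\in\mathbb{N}$. The upper Lyapunov exponent $\lambda^+(A)\ge 0$ is the number such that $$\lambda^{+}(A)=\lim_{n\to+\infty}\frac1n\log\|A^n(x)\|\quad\text{for $\mu$-a.e. } x\in X$$ (which exists under these conditions). *)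

(* Defs.v *)
From HB Require Import structures.
From mathcomp Require Import all_boot all_order all_algebra.
From mathcomp Require Import all_classical all_reals all_analysis.

Set Implicit Arguments.
Unset Strict Implicit.
Unset Printing Implicit Defensive.

Import Order.TTheory GRing.Theory Num.Theory.
Import numFieldNormedType.Exports.

Local Open Scope classical_set_scope.
Local Open Scope ring_scope.

Definition enorm (R : realType) (v : 'cV[R]_2) : R :=
  Num.sqrt (\sum_(i < 2) v i ord0 ^+ 2).

(* The library's norm on matrices is the maximum of the absolute values of the
   entries, hence this separate definition of the operator norm. *)
Definition opnorm (R : realType) (M : 'M[R]_2) : R :=
  sup [set enorm (M *m v) | v in [set v : 'cV[R]_2 | enorm v = 1]].

Definition rotmx (R : realType) (theta : R) : 'M[R]_2 :=
  \matrix_(i < 2, j < 2)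
    if i == j then cos theta else if i == ord0 then - sin theta else sin theta.

(* Measurability with respect to the Borel sets of the space of matrices. *)
Definition borel_measurable_mx d (X : measurableType d) (R : realType)
    (A : X -> 'M[R]_2) : Prop :=
  measurable_fun [set: X] (A : X -> g_sigma_algebraType (@open 'M[R]_2)).

Definition measure_preserving d (X : measurableType d) (R : realType)
    (mu : {measure set X -> \bar R}) (T : X -> X) : Prop :=
  measurable_fun [set: X] T /\
  forall E : set X, measurable E -> mu (T @^-1` E) = mu E.

Definition ergodic d (X : measurableType d) (R : realType)
    (mu : probability X R) (T : X -> X) : Prop :=
  measure_preserving mu T /\
  forall E : set X, measurable E -> T @^-1` E = E ->
    mu E = 0%E \/ mu E = 1%E.

Fixpoint cocycle (X : Type) (R : realType) (T : X -> X) (A : X -> 'M[R]_2)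
    (n : nat) (x : X) : 'M[R]_2 :=
  if n is m.+1 then A (iter m T x) *m cocycle T A m x else 1%:M.

(* "The number l such that ...": any such l is unique when mu is a probability
   measure; the value is 0 by convention if there is none. *)
Definition upper_lyapunov d (X : measurableType d) (R : realType)
    (mu : probability X R) (T : X -> X) (A : X -> 'M[R]_2) : R :=
  xget 0 [set l : R | {ae mu, forall x,
    n%:R^-1 * ln (opnorm (cocycle T A n x)) @[n --> \oo] --> l}].

(* Main.v *)
(** Identify R^2 with C, so that a matrix [M] acts as [z |-> a z + b zbar]; then
    [opnorm M = |a| + |b|] and [det M = |a|^2 - |b|^2], so for determinant 1
    [(opnorm M + (opnorm M)^-1) / 2 = |a|] and [|a| <= opnorm M <= 2 |a|], while
    [R_t] has [a = e^{it}] and [b = 0].  Let [a_n(t, x)] be the coefficient [a]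
    of the [n]-th iterate of [A R_t].  Up to a factor of modulus 1 and complex
    conjugation, [a_n(t, x)] is [P_n(e^{it})] for a polynomial [P_n] whose
    constant term has modulus [prod_(i < n) |a (A (T^i x))|].  On the closed unit
    disc the recursion preserves [|P_n|^2 >= 1 + |Q_n|^2], where [Q_n] plays the
    same role for [b], so [P_n] has no zero there and by Jensen's formula the mean
    over [t] of [ln |P_n(e^{it})|] is [sum_(i < n) ln |a (A (T^i x))|].  Hence the
    mean over [t] of [ln (opnorm (A R_t)^n(x))] is this Birkhoff sum, up to an
    error in [0, ln 2].  Integrating over [x], dividing by [n] and letting [n] go
    to infinity (subadditive ergodic theorem for each [t], then dominated
    convergence in [t]) gives the formula. *)
Require Import Defs.
From HB Require Import structures.
From mathcomp Require Import all_boot all_order all_algebra.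
From mathcomp Require Import ring lra zify.
From mathcomp Require Import all_classical all_reals all_analysis.
From mathcomp Require Import measurable_realfun complex.

Import Order.TTheory GRing.Theory Num.Theory.
Import numFieldNormedType.Exports.

Set Implicit Arguments.
Unset Strict Implicit.
Unset Printing Implicit Defensive.

Local Open Scope classical_set_scope.
Local Open Scope ring_scope.

(** * Subadditive sequences along orbits *)

Section BirkhoffSums.
Context {X : Type} {R : realType} (T : X -> X).
Implicit Types (f u phi : X -> R) (h : nat -> X -> R).

Definition bsum f n x : R := \sum_(i < n) f (iter i T x).

Lemma bsum0 f x : bsum f 0 x = 0.
Proof. by rewrite /bsum big_ord0. Qed.

Lemma bsum1 f x : bsum f 1 x = f x.
Proof. by rewrite /bsum big_ord1. Qed.

Lemma bsumD f m n x : bsum f (m + n) x = bsum f m x + bsum f n (iter m T x).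
Proof.
rewrite /bsum big_split_ord; congr (_ + _).
by apply: eq_bigr => i _; rewrite /= addnC iterD.
Qed.

Lemma bsumS f n x : bsum f n.+1 x = f x + bsum f n (T x).
Proof. by rewrite -add1n bsumD bsum1. Qed.

Lemma bsum_ge0 f n x : (forall y, 0 <= f y) -> 0 <= bsum f n x.
Proof. by move=> f0; apply: sumr_ge0. Qed.

Lemma bsum_mono f m n x :
  (forall y, 0 <= f y) -> (m <= n)%N -> bsum f m x <= bsum f n x.
Proof. by move=> f0 /subnKC <-; rewrite bsumD lerDl bsum_ge0. Qed.

Definition subadditive_cocycle h :=
  (forall x, h 0 x = 0) /\
  forall m n x, h (m + n)%N x <= h m x + h n (iter m T x).

Lemma subadditive_bsum f : subadditive_cocycle (bsum f).
Proof. by split=> [x|m n x]; rewrite ?bsum0// bsumD. Qed.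

Lemma subadditive_bsumN f : subadditive_cocycle (fun n x => - bsum f n x).
Proof. by split=> [x|m n x]; rewrite ?bsum0 ?oppr0// bsumD opprD. Qed.

Lemma subadditive_le_bsum h u c : subadditive_cocycle h ->
  (forall x, h 1 x <= c + u x) ->
  forall n x, h n x <= n%:R * c + bsum u n x.
Proof.
move=> [h0 hD] h1; elim=> [|n IHn] x; first by rewrite h0 bsum0 mul0r addr0.
rewrite -add1n (le_trans (hD _ _ _))// bsumD bsum1 natrD mulrDl mul1r.
by rewrite addrACA lerD.
Qed.

(** Each difference is the sum of [u] over the last [N] points of an orbit segment, or over the
    whole segment if it is shorter. Dropping the first [l] points keeps the same endpoint, so it can
    only shrink this window. *)
Lemma bsum_tail_le u (l n N : nat) x : (forall y, 0 <= u y) -> (l <= n)%N ->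
  bsum u (n - l) (iter l T x) - bsum u (n - l - N) (iter l T x) <=
  bsum u n x - bsum u (n - N) x.
Proof.
move=> u0 ln.
have -> : bsum u n x = bsum u l x + bsum u (n - l) (iter l T x).
  by rewrite -bsumD subnKC.
have [lnN|nNl] := leqP l (n - N).
  have -> : (n - N = l + (n - l - N))%N by lia.
  by rewrite bsumD; lra.
have -> : (n - l - N = 0)%N by lia.
by rewrite bsum0; have := bsum_mono x u0 (ltnW nNl); lra.
Qed.

(* The orbit segment of length [n] is cut greedily into blocks of length at
   most [N] on which [h] has average at most [c]; single steps from points
   where no such block starts cost [phi], and a last incomplete block costs
   [u] per step. *)
Lemma subadditive_covering h u phi c N : subadditive_cocycle h ->
  (forall x, 0 <= u x) -> (forall x, h 1 x <= c + u x) ->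
  (forall x, 0 <= phi x) ->
  (forall x, (exists l, [/\ (0 < l)%N, (l <= N)%N & h l x <= l%:R * c]) \/
             u x <= phi x) ->
  forall n x, h n x <=
    n%:R * c + bsum phi n x + (bsum u n x - bsum u (n - N) x).
Proof.
move=> hsub u0 h1 phi0 hcov n.
have [h0 hD] := hsub.
elim/ltn_ind: n => n IH x.
(* Once a first block of length [l] is paid for, the induction hypothesis covers the remaining
   [n - l] points. *)
have step l : (0 < l)%N -> (l <= n)%N ->
    h l x <= l%:R * c + bsum phi l x ->
    h n x <= n%:R * c + bsum phi n x + (bsum u n x - bsum u (n - N) x).
  move=> l0 ln hl.
  have ltnl : (n - l < n)%N by lia.
  have := IH _ ltnl (iter l T x).
  have := bsum_tail_le N x u0 ln.
  have := hD l (n - l)%N x; rewrite subnKC//.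
  have -> : bsum phi n x = bsum phi l x + bsum phi (n - l) (iter l T x).
    by rewrite -bsumD subnKC.
  have -> : n%:R = l%:R + (n - l)%:R :> R by rewrite -natrD subnKC.
  move: (bsum _ _ _) (bsum _ _ _) (bsum _ _ _) (bsum _ _ _) (bsum _ _ _).
  by move=> *; lra.
have [->|n0] := posnP n; first by rewrite h0 !bsum0; lra.
have [[l [l0 lN hl]]|uphi] := hcov x; last first.
  by apply: (step 1%N) => //; rewrite bsum1; have := h1 x; lra.
have [ln|nl] := leqP l n.
  by apply: (step l) => //; have := bsum_ge0 l x phi0; lra.
(* Here [n < l <= N]: the block overruns the segment, so the tail term is the whole sum of [u] and
   pays for every step. *)
have -> : (n - N = 0)%N by lia.
have := subadditive_le_bsum hsub h1 n x.
by have := bsum_ge0 n x phi0; rewrite bsum0; lra.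
Qed.

End BirkhoffSums.

(** * Integrals of Birkhoff sums under a measure-preserving map *)

Section MeasurePreserving.
Context {d} {X : measurableType d} {R : realType} {mu : probability X R}.
Context {T : X -> X} (T_mp : measure_preserving mu T).
Implicit Types f : X -> R.

Local Notation intg f := (mu.-integrable setT (EFin \o f)).

Lemma measurable_iter n : measurable_fun [set: X] (iter n T).
Proof.
have [mT _] := T_mp.
by elim: n => [|n IHn]; [exact: measurable_id|exact: measurableT_comp].
Qed.

Lemma ge0_integral_measure_preserving (g : X -> \bar R) :
  measurable_fun [set: X] g -> (forall x, 0 <= g x)%E ->
  (\int[mu]_x g (T x) = \int[mu]_x g x)%E.
Proof.
have [mT Tmu] := T_mp => mg g0.
rewrite -[LHS](ge0_integral_pushforward mT mu (D := setT) (f := g))//.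
by apply: eq_measure_integral => A mA _; exact: Tmu.
Qed.

Lemma integrable_measure_preserving f : intg f -> intg (f \o T).
Proof.
have [mT Tmu] := T_mp => /integrableP[mf fi]; apply/integrableP; split.
  exact: measurableT_comp mf mT.
rewrite (ge0_integral_measure_preserving (g := fun x => `|(f x)%:E|%E))//.
exact: measurableT_comp.
Qed.

Lemma Rintegral_measure_preserving f : intg f ->
  \int[mu]_x f (T x) = \int[mu]_x f x.
Proof.
have [mT Tmu] := T_mp => fi; congr fine.
rewrite -[LHS](integral_pushforward mT (mu := mu) (D := setT) (f := EFin \o f))//.
- by apply: eq_measure_integral => A mA _; exact: Tmu.
- exact: measurable_int fi.
- by rewrite preimage_setT; exact: integrable_measure_preserving.
Qed.

Lemma integrable_bsum f n : intg f -> intg (bsum T f n).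
Proof.
move=> fi; elim: n => [|n IHn].
  by rewrite (_ : _ \o _ = cst 0%E) ?integrable0//; apply/funext => x /=;
    rewrite bsum0.
rewrite (_ : _ \o _ = ((EFin \o f) \+ (EFin \o (bsum T f n \o T)))%E).
  by apply: integrableD => //; exact: integrable_measure_preserving.
by apply/funext => x /=; rewrite bsumS EFinD.
Qed.

Lemma Rintegral_bsum f n : intg f ->
  \int[mu]_x bsum T f n x = n%:R * \int[mu]_x f x.
Proof.
move=> fi; elim: n => [|n IHn].
  rewrite mul0r -[RHS](mul0r (fine (mu setT))) -Rintegral_cst//.
  by apply: eq_Rintegral => x _; rewrite bsum0.
under eq_Rintegral do rewrite bsumS.
have bi := integrable_bsum n fi.
rewrite RintegralD//; last exact: integrable_measure_preserving.
by rewrite Rintegral_measure_preserving// IHn mulrSr mulrDl mul1r addrC.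
Qed.

Lemma Rintegral_prob_cst (c : R) : \int[mu]_x c = c.
Proof.
have mu1 : mu setT = 1%E by exact: probability_setT.
rewrite Rintegral_cst// -[RHS]mulr1.
by congr (_ * _); exact: (congr1 fine mu1).
Qed.

End MeasurePreserving.

(** * Linear growth rates of real sequences *)

Section LinearGrowth.
Context {R : realType}.
Implicit Types (a : nat -> R) (L : R).

(** This encodes [limsup a n / n <= L] without division: the constant [K] absorbs the small [n],
    including [n = 0]. *)
Definition growth_le a L :=
  forall e, 0 < e -> exists K, forall n, a n <= n%:R * (L + e) + K.

Definition growth_ge a L := growth_le (fun n => - a n) (- L).

Lemma growth_le_bound a L K : (forall n, a n <= n%:R * L + K) -> growth_le a L.
Proof.
move=> aL e e0; exists K => n; apply: (le_trans (aL n)).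
by rewrite lerD2r ler_wpM2l// lerDl ltW.
Qed.

Lemma growth_le_inf a L :
  (forall k, growth_le a (L + k.+1%:R^-1)) -> growth_le a L.
Proof.
move=> aL e e0; have e20 : 0 < e / 2 by rewrite divr_gt0.
have [k ke] : exists k, k.+1%:R^-1 < e / 2.
  have [k _ kP] := near_infty_natSinv_lt (PosNum e20).
  by exists k; exact: kP (leqnn k).
have [K aK] := aL k _ e20; exists K => n; apply: (le_trans (aK n)).
rewrite lerD2r ler_wpM2l// -addrA lerD2l.
by rewrite [leRHS](splitr e) lerD2r ltW.
Qed.

Lemma growth_le_mono a b L M : (forall n, a n <= b n) -> L <= M ->
  growth_le b L -> growth_le a M.
Proof.
move=> ab LM bL e e0; have [K bK] := bL _ e0; exists K => n.
by rewrite (le_trans (ab n))// (le_trans (bK n))// lerD2r ler_wpM2l// lerD2r.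
Qed.

(** Truncated subtraction changes [n] by at most [N], so the linear bound moves by at most
    [N * |L + e|], which the constant absorbs. *)
Lemma growth_le_shift a L N :
  growth_le a L -> growth_le (fun n => a (n - N)%N) L.
Proof.
move=> aL e e0; have [K aK] := aL _ e0.
exists (N%:R * `|L + e| + K) => n; apply: (le_trans (aK _)).
rewrite addrA lerD2r -lerBlDl -mulrBl; apply: (le_trans (ler_norm _)).
rewrite normrM ler_wpM2r//.
have [nN|Nn] := leqP n N.
  by rewrite (eqP (nN : n - N == 0)%N) sub0r normrN ger0_norm ?ler_nat.
by rewrite natrB ?(ltnW Nn)// addrAC subrr sub0r normrN ger0_norm.
Qed.

Lemma growth_leD a b L M :
  growth_le a L -> growth_le b M -> growth_le (fun n => a n + b n) (L + M).
Proof.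
move=> aL bM e e0; have e20 : 0 < e / 2 by rewrite divr_gt0.
have [K aK] := aL _ e20; have [J bJ] := bM _ e20.
exists (K + J) => n; apply: (le_trans (lerD (aK n) (bJ n))).
by rewrite le_eqVlt; apply/orP; left; apply/eqP; field.
Qed.

Lemma growth_le_compare a L M :
  growth_ge a L -> growth_le a M -> L <= M.
Proof.
move=> aL aM; rewrite leNgt; apply/negP => ML.
(* With a third of the gap as [e], the two bounds leave [n * e <= K + J] for all [n], which fails
   for large [n]. *)
have e0 : 0 < (L - M) / 3 by rewrite divr_gt0// subr_gt0.
have [K aK] := aL _ e0; have [J bJ] := aM _ e0.
set e := (L - M) / 3 in e0 aK bJ; have Le : L = M + 3 * e by rewrite /e; field.
have [n] : exists n : nat, (K + J) / e < n%:R.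
  by exists (Num.truncn ((K + J) / e)).+1; exact: truncnS_gt.
rewrite ltr_pdivrMr// => KJn.
by have := aK n; have := bJ n; rewrite Le; lra.
Qed.

Lemma growth_cvg a L : growth_le a L -> growth_ge a L ->
  n%:R^-1 * a n @[n --> \oo] --> L.
Proof.
move=> aL La; apply/cvgrPdist_le => e e0.
have e20 : 0 < e / 2 by rewrite divr_gt0.
have [K aK] := aL _ e20; have [J aJ] := La _ e20.
near=> n.
have n0 : (0 : R) < n%:R by rewrite ltr0n; near: n; exists 1%N.
have nK : K / (e / 2) <= n%:R by near: n; exact: nbhs_infty_ger.
have nJ : J / (e / 2) <= n%:R by near: n; exact: nbhs_infty_ger.
rewrite ler_pdivrMr// in nK; rewrite ler_pdivrMr// in nJ.
have -> : L - n%:R^-1 * a n = n%:R^-1 * (n%:R * L - a n).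
  by rewrite mulrBr mulKf// gt_eqF.
rewrite normrM gtr0_norm ?invr_gt0// ler_pdivrMl// ler_norml.
by have := aK n; have := aJ n; move=> *; apply/andP; split; lra.
Unshelve. all: by end_near. Qed.

End LinearGrowth.

Lemma Rintegral_dominated_cvg {d} {X : measurableType d} {R : realType}
    {mu : {measure set X -> \bar R}} {D : set X} (F : nat -> X -> R) (f g : X -> R) :
  measurable D ->
  (forall n, measurable_fun D (F n)) -> measurable_fun D f ->
  {ae mu, forall x, D x -> F n x @[n --> \oo] --> f x} ->
  mu.-integrable D (EFin \o g) -> (forall n x, D x -> `|F n x| <= g x) ->
  mu.-integrable D (EFin \o f) /\
  (\int[mu]_(x in D) F n x) @[n --> \oo] --> \int[mu]_(x in D) f x.
Proof.
move=> mD mF mf Ff ig Fg.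
have [|||||fi _ Fcvg] := @dominated_convergence _ _ _ mu _ mD
  (fun n x => (F n x)%:E) (EFin \o f) (EFin \o g).
- by move=> n; exact/measurable_EFinP.
- exact/measurable_EFinP.
- apply: filterS Ff => x Ffx Dx; apply: cvg_EFin (Ffx Dx).
  exact: nearW.
- exact: ig.
- by apply: aeW => x n Dx; rewrite /= lee_fin; exact: Fg.
split=> //.
move: Fcvg; rewrite -[X in _ --> X -> _]fineK; last exact: integrable_fin_num.
exact: fine_cvg.
Qed.

(** * Zero-one dichotomy for slopes, and the cost of coverings *)

Section SubadditiveErgodic.
Context {d} {X : measurableType d} {R : realType} {mu : probability X R}.
Context {T : X -> X} (T_ergodic : ergodic mu T).
Implicit Types (f : X -> R) (h : nat -> X -> R).

Let T_mp : measure_preserving mu T := proj1 T_ergodic.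

Local Notation intg f := (mu.-integrable setT (EFin \o f)).

Lemma integrable_measurable f : intg f -> measurable_fun [set: X] f.
Proof. by move=> /integrableP[/measurable_EFinP]. Qed.

Lemma measurable_le_cst f (c : R) : measurable_fun [set: X] f ->
  measurable [set x | f x <= c].
Proof.
move=> mf; rewrite -[X in measurable X]setTI.
rewrite (_ : [set x | _] = f @^-1` `]-oo, c]); first exact: mf.
by apply/seteqP; split=> x /=; rewrite in_itv.
Qed.

Lemma measurable_ge_cst f (c : R) : measurable_fun [set: X] f ->
  measurable [set x | c <= f x].
Proof.
move=> mf; rewrite -[X in measurable X]setTI.
rewrite (_ : [set x | _] = f @^-1` `[c, +oo[); first exact: mf.
by apply/seteqP; split=> x /=; rewrite in_itv/= andbT.
Qed.

(** The preimages of [E] under the iterates of [T] increase and all have measure [mu E]. Their union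
    therefore has the same measure, and it is strictly invariant, so ergodicity applies to it. *)
Lemma ergodic_subinvariant (E : set X) : measurable E -> E `<=` T @^-1` E ->
  mu E = 0%E \/ mu E = 1%E.
Proof.
have [[mT Tmu] erg] := T_ergodic => mE ET.
pose F n := iter n T @^-1` E.
have mF n : measurable (F n).
  by rewrite /F -[X in measurable X]setTI; exact: (measurable_iter T_mp).
have muF n : mu (F n) = mu E.
  elim: n => // n <-; rewrite -[RHS]Tmu//; congr (mu _).
  by apply/funext => x; rewrite /F /preimage/mkset iterSr.
have mUF : measurable (\bigcup_n F n) by exact: bigcup_measurable.
have FS n : F n `<=` F n.+1 by move=> x /ET.
have ndF : {homo F : n m / (n <= m)%N >-> (n <= m)%O}.
  by apply: homo_leq => [//|? ? ?|n]; [exact: le_trans|exact/subsetPset].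
have cvgF := nondecreasing_cvg_mu mF mUF ndF (mu := mu).
have muUF : mu (\bigcup_n F n) = mu E.
  have : (mu \o F) x @[x --> \oo] --> mu E.
    by apply: cvg_near_cst; apply: nearW => n; rewrite /= muF.
  by move/cvg_lim => <-//; move/cvg_lim : cvgF => <-.
have FT n x : F n.+1 x = F n (T x) by rewrite /F /preimage/mkset iterSr.
rewrite -muUF; apply: erg => //; apply/seteqP; split=> x [n _ Fn].
  by exists n.+1 => //; rewrite FT.
by exists n => //; rewrite /mkset -FT; exact: FS.
Qed.

(** The error is bounded, which is stronger than [growth_ge]; a natural number [K] makes the set a
    countable union of countable intersections. *)
Definition linear_minorant h (c : R) : set X :=
  [set x | exists K : nat, forall n, n%:R * c - K%:R <= h n x].

Lemma measurable_linear_minorant h c :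
  (forall n, measurable_fun [set: X] (h n)) ->
  measurable (linear_minorant h c).
Proof.
move=> mh; rewrite (_ : linear_minorant h c =
    \bigcup_K \bigcap_n [set x | n%:R * c - K%:R <= h n x]); last first.
  apply/seteqP; split=> x /= [K].
    by move=> hK; exists K => // n _ /=.
  by move=> _ hK; exists K => n; exact: (hK n I).
apply: bigcup_measurable => K _; apply: bigcap_measurable => //.
by move=> n _; exact: measurable_ge_cst.
Qed.

(** Subadditivity makes [linear_minorant h c] subinvariant, hence null or of full measure. A point
    where no block of positive length has average at most [c] lies in it with [K = 0]. *)
Lemma linear_minorant_or h c : subadditive_cocycle T h ->
  (forall n, measurable_fun [set: X] (h n)) ->
  {ae mu, forall x, linear_minorant h c x} \/
  {ae mu, forall x, exists2 l, (0 < l)%N & h l x <= l%:R * c}.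
Proof.
move=> [h0 hD] mh.
have mE := measurable_linear_minorant c mh.
have ET : linear_minorant h c `<=` T @^-1` linear_minorant h c.
  (* From [h n.+1 x <= h 1 x + h n (T x)] follows [h n (T x) >= n * c + c - K - h 1 x], whence the
     new constant. *)
  move=> x [K hK]; exists (Num.truncn (K%:R + `|c| + `|h 1 x|)).+1 => n.
  have := hD 1%N n x; have := hK n.+1; rewrite add1n /= -natr1.
  have := truncnS_gt (K%:R + `|c| + `|h 1 x|).
  have := ler_norm (h 1 x); have := ler_norm (- c); rewrite normrN.
  by move: (_.+1)%:R => z; lra.
have [mu0|mu1] := ergodic_subinvariant mE ET.
  right; exists (linear_minorant h c); split => // x /= hx.
  exists 0 => n; rewrite subr0 leNgt; apply/negP => hn; apply: hx.
  exists n; last exact: ltW.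
  by rewrite lt0n; apply/eqP => n0; move: hn; rewrite n0 h0 mul0r ltxx.
left; exists (~` linear_minorant h c); split => //.
  exact: measurableC.
have := probability_setC mu mE; rewrite [X in (1 - X)%E](_ : _ = 1%E)// => ->.
by rewrite subee.
Qed.

(* The set where no block of length at most [N] starts shrinks to a null set,
   so dominated convergence makes its cost small. *)
Lemma small_covering_cost h u c :
  (forall n, measurable_fun [set: X] (h n)) ->
  intg u -> (forall x, 0 <= u x) ->
  {ae mu, forall x, exists2 l, (0 < l)%N & h l x <= l%:R * c} ->
  forall e, 0 < e -> exists N (phi : X -> R),
    [/\ forall x, 0 <= phi x, intg phi, \int[mu]_x phi x < e &
     forall x, (exists l, [/\ (0 < l)%N, (l <= N)%N & h l x <= l%:R * c]) \/
               u x <= phi x].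
Proof.
move=> mh iu u0 hae e e0.
pose G N := [set x | exists l, [/\ (0 < l)%N, (l <= N)%N & h l x <= l%:R * c]].
have mG N : measurable (G N).
  rewrite (_ : G N = \bigcup_(l in [set l | (0 < l)%N /\ (l <= N)%N])
    [set x | h l x <= l%:R * c]); last first.
    apply/seteqP; split => x /= [l]; first by move=> [? ? ?]; exists l.
    by move=> [? ?] ?; exists l.
  by apply: bigcup_measurable => l _; exact: measurable_le_cst.
pose phi N := u \_ (~` G N).
have phi0 N x : 0 <= phi N x by rewrite /phi patchE; case: ifP.
have phiu N x : phi N x <= u x by rewrite /phi patchE; case: ifP.
have mphi N : measurable_fun [set: X] (phi N).
  apply/(measurable_restrictT _ _).1 => //; first exact: measurableC.
  by apply: measurable_funTS; exact: integrable_measurable.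
have iphi N : intg (phi N).
  apply: (le_integrable _ _ _ iu) => //; first exact/measurable_EFinP.
  by move=> x _ /=; rewrite lee_fin !ger0_norm.
have phi_cvg : {ae mu, forall x, phi N x @[N --> \oo] --> 0}.
  apply: filterS hae => x [l l0 hl]; apply: cvg_near_cst.
  exists l => // N /= lN; rewrite /phi patchE ifF//.
  by apply/negbTE; rewrite notin_setE/=; apply; exists l.
have : (\int[mu]_x phi N x) @[N --> \oo] --> (0 : R).
  rewrite -[X in _ --> X](Rintegral_prob_cst (mu := mu)).
  apply: (Rintegral_dominated_cvg _ _ _ _ iu _).2 => //.
    by apply: filterS phi_cvg.
  by move=> N x _; rewrite ger0_norm.
move=> /cvgrPdist_lt /(_ e e0)[N _ /(_ N (leqnn N))].
rewrite /= sub0r normrN => phiN.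
exists N, (phi N); split => //; first exact: le_lt_trans (ler_norm _) phiN.
move=> x; have [Gx|nGx] := pselect (G N x); [by left|right].
by rewrite /phi patchE ifT// inE.
Qed.

End SubadditiveErgodic.

(** * The ergodic theorems of Birkhoff and Kingman *)

Section Kingman.
Context {d} {X : measurableType d} {R : realType} {mu : probability X R}.
Context {T : X -> X} (T_ergodic : ergodic mu T).
Implicit Types (f : X -> R) (h : nat -> X -> R).

Let T_mp : measure_preserving mu T := proj1 T_ergodic.

Local Notation intg f := (mu.-integrable setT (EFin \o f)).

Lemma covering_growth h c : subadditive_cocycle T h ->
  (forall n, intg (h n)) ->
  {ae mu, forall x, exists2 l, (0 < l)%N & h l x <= l%:R * c} ->
  forall e, 0 < e -> exists N (phi u : X -> R),
    [/\ intg phi, intg u, \int[mu]_x phi x < e &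
     forall n x, h n x <=
       n%:R * c + bsum T phi n x + (bsum T u n x - bsum T u (n - N) x)].
Proof.
move=> hsub ih hae e e0.
(* This choice is nonnegative and integrable, and it gives [h 1 x <= c + u x], the bound required on
   a single step. *)
pose u x : R := `|h 1%N x| + `|c|.
have iu : intg u.
  rewrite (_ : _ \o _ = (EFin \o (fun x => `|h 1%N x|%R)) \+ (EFin \o cst `|c|%R))%E//.
  apply: integrableD => //; first exact: (integrable_norm (ih 1%N)).
  exact: finite_measure_integrable_cst.
have u0 x : 0 <= u x by rewrite addr_ge0.
have mh n := integrable_measurable (ih n).
have [N [phi [phi0 iphi phie hcov]]] := small_covering_cost mh iu u0 hae e0.
exists N, phi, u; split => // n x.
apply: subadditive_covering => // y; rewrite /u.
by have := ler_norm (h 1%N y); have := ler_norm (- c); rewrite normrN; lra.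
Qed.

(** The covering bound is integrated: by invariance the sum of [phi] contributes less than [n * e],
    and the tail at most [N] times the modulus of the integral of [u], independently of [n]. *)
Lemma Rintegral_growth_le h c : subadditive_cocycle T h ->
  (forall n, intg (h n)) ->
  {ae mu, forall x, exists2 l, (0 < l)%N & h l x <= l%:R * c} ->
  growth_le (fun n => \int[mu]_x h n x) c.
Proof.
move=> hsub ih hae e e0.
have [N [phi [u [iphi iu phie hle]]]] := covering_growth hsub ih hae e0.
exists (N%:R * `|\int[mu]_x u x|) => n.
have ip m : intg (bsum T phi m) by exact: (integrable_bsum T_mp).
have iU m : intg (bsum T u m) by exact: (integrable_bsum T_mp).
have ic : intg (cst (n%:R * c)) by exact: finite_measure_integrable_cst.
have i1 : intg (fun x => n%:R * c + bsum T phi n x).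
  by rewrite (_ : _ \o _ = (EFin \o cst (n%:R * c)%R) \+ (EFin \o bsum T phi n))%E//;
    exact: integrableD.
have i2 : intg (fun x => bsum T u n x - bsum T u (n - N) x).
  by rewrite (_ : _ \o _ = (EFin \o bsum T u n) \- (EFin \o bsum T u (n - N)%N))%E//;
    exact: integrableB.
apply: (@le_trans _ _ (\int[mu]_x (n%:R * c + bsum T phi n x +
    (bsum T u n x - bsum T u (n - N) x)))).
  apply: le_Rintegral => //.
  rewrite (_ : _ \o _ = (EFin \o (fun x => n%:R * c + bsum T phi n x)%R) \+
    (EFin \o (fun x => bsum T u n x - bsum T u (n - N) x)%R))%E//.
  exact: integrableD.
rewrite RintegralD// [X in X + _]RintegralD// [X in _ + X]RintegralB//.
rewrite Rintegral_prob_cst.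
rewrite !(Rintegral_bsum T_mp)// -mulrBl mulrDr lerD//.
  by rewrite lerD2l ler_wpM2l// ltW.
apply: (le_trans (ler_norm _)); rewrite normrM ler_wpM2r//.
have [nN|Nn] := leqP n N.
  by rewrite (_ : (n - N = 0)%N) ?subr0 ?ger0_norm ?ler_nat//; apply/eqP.
by rewrite natrB ?(ltnW Nn)// opprB addrC subrK ger0_norm.
Qed.

Lemma linear_minorant_growth h c x :
  linear_minorant h c x -> growth_ge (h ^~ x) c.
Proof.
move=> [K hK]; apply: (@growth_le_bound _ _ _ K%:R) => n.
by have := hK n; lra.
Qed.

(** For each slope below [L] the dichotomy applies. Its second alternative would bound the growth of
    the integrals by that slope, against the assumption on them. *)
Lemma ae_growth_ge h L : subadditive_cocycle T h -> (forall n, intg (h n)) ->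
  (forall n, n%:R * L <= \int[mu]_x h n x) ->
  {ae mu, forall x, growth_ge (h ^~ x) L}.
Proof.
move=> hsub ih hL.
have mh n := integrable_measurable (ih n).
have : {ae mu, forall x k, growth_ge (h ^~ x) (L - k.+1%:R^-1)}.
  apply: ae_foralln => k.
  have [|hae] := linear_minorant_or T_ergodic (L - k.+1%:R^-1) hsub mh.
    by apply: filterS => x; exact: linear_minorant_growth.
  have := Rintegral_growth_le hsub ih hae.
  have hL' : growth_ge (fun n => \int[mu]_x h n x) L.
    by apply: (@growth_le_bound _ _ _ 0) => n; have := hL n; lra.
  move=> /(growth_le_compare hL'); rewrite lerBrDr gerDl leNgt.
  by rewrite invr_gt0 ltr0n.
apply: filterS => x hx; apply: growth_le_inf => k.
by have := hx k; rewrite /growth_ge opprB addrC.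
Qed.

(** Birkhoff sums and their negatives are both subadditive, so the lower bound [ae_growth_ge]
    applied to each gives both inequalities. *)
Theorem ergodic_theorem f : intg f ->
  {ae mu, forall x, growth_le (bsum T f ^~ x) (\int[mu]_x f x) /\
                    growth_ge (bsum T f ^~ x) (\int[mu]_x f x)}.
Proof.
move=> fi.
have ib n := integrable_bsum T_mp n fi.
have ibN n : intg (fun x => - bsum T f n x) by exact: integrableN (ib n).
have lo : {ae mu, forall x, growth_ge (bsum T f ^~ x) (\int[mu]_x f x)}.
  apply: ae_growth_ge => //; first exact: subadditive_bsum.
  by move=> n; rewrite (Rintegral_bsum T_mp).
have hi : {ae mu, forall x,
    growth_ge (fun n => - bsum T f n x) (- \int[mu]_x f x)}.
  apply: ae_growth_ge => //; first exact: subadditive_bsumN.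
  move=> n; have -> : \int[mu]_x (- bsum T f n x) = - \int[mu]_x bsum T f n x.
    by under [LHS]eq_Rintegral do rewrite -mulN1r; rewrite RintegralZl// mulN1r.
  by rewrite (Rintegral_bsum T_mp)// mulrN.
apply: filterS2 lo hi => x ? /=; rewrite /growth_ge opprK.
under eq_fun do rewrite opprK.
by split.
Qed.

(** The covering bound is now read pointwise: by the ergodic theorem the sum of [phi] grows with
    slope below [k.+1%:R^-1], while the tail is a difference of two sums of equal growth, hence
    sublinear. *)
Lemma ae_growth_le h c : subadditive_cocycle T h -> (forall n, intg (h n)) ->
  {ae mu, forall x, exists2 l, (0 < l)%N & h l x <= l%:R * c} ->
  {ae mu, forall x, growth_le (h ^~ x) c}.
Proof.
move=> hsub ih hae.
have : {ae mu, forall x k, growth_le (h ^~ x) (c + k.+1%:R^-1)}.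
  apply: ae_foralln => k; have k0 : (0 : R) < k.+1%:R^-1 by rewrite invr_gt0.
  have [N [phi [u [iphi iu phik hle]]]] := covering_growth hsub ih hae k0.
  apply: filterS2 (ergodic_theorem iphi) (ergodic_theorem iu).
  move=> x [phiL _] [uL uG].
  have cL : growth_le (fun n => n%:R * c) c.
    by apply: (@growth_le_bound _ _ _ 0) => n; rewrite addr0.
  have := growth_leD (growth_leD cL phiL)
    (growth_leD uL (growth_le_shift N uG)).
  apply: growth_le_mono => [n|]; first exact: hle.
  by rewrite subrr addr0 lerD2l ltW.
by apply: filterS => x; exact: growth_le_inf.
Qed.

(** For [c > 0], a single constant [K] serves on a set of measure close to 1, and off this set
    nonnegativity of [h] bounds the integral from below. *)
Lemma Rintegral_growth_ge h c : (forall n, intg (h n)) ->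
  (forall n x, 0 <= h n x) -> {ae mu, forall x, linear_minorant h c x} ->
  growth_ge (fun n => \int[mu]_x h n x) c.
Proof.
move=> ih h0 hae e e0.
have mh n := integrable_measurable (ih n).
have int0 n : 0 <= \int[mu]_x h n x by apply: Rintegral_ge0.
have [c0|c0] := leP c 0.
  exists 0 => n; rewrite addr0 (@le_trans _ _ 0) ?oppr_le0//.
  by rewrite mulr_ge0// addr_ge0 ?oppr_ge0// ltW.
pose E (K : nat) := [set x | forall n, n%:R * c - K%:R <= h n x].
have mE K : measurable (E K).
  rewrite (_ : E K = \bigcap_n [set x | n%:R * c - K%:R <= h n x]).
    by apply: bigcap_measurable => // n _; exact: measurable_ge_cst.
  by apply/seteqP; split=> x /= hK n; [move=> _|]; exact: hK.
have UE : \bigcup_K E K = linear_minorant h c.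
  by apply/seteqP; split=> x [K]; [move=> _|]; exists K.
have mUE : measurable (\bigcup_K E K) by exact: bigcup_measurable.
have muUE : mu (\bigcup_K E K) = 1%E.
  have /(negligibleP _ (measurableC mUE)) : mu.-negligible (~` \bigcup_K E K).
      by rewrite UE.
  move=> muC; have := probability_setC mu mUE.
  rewrite [X in X = _](_ : _ = 0%E)// => /esym/eqP.
  by rewrite sube_eq// add0e => /eqP /esym.
have ndE : {homo E : n m / (n <= m)%N >-> (n <= m)%O}.
  move=> K J KJ; apply/subsetPset => x hx n; apply: le_trans (hx n).
  by rewrite lerD2l lerN2 ler_nat.
have : (mu \o E) K @[K --> \oo] --> (1 : R)%:E.
  by rewrite -muUE; exact: (nondecreasing_cvg_mu mE mUE ndE (mu := mu)).
(* With missing measure below [e / c], the loss in the main term [n * c] is at most [n * e]. *)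
move=> /fine_cvg /cvgrPdist_lt /(_ (e / c)).
rewrite divr_gt0// => /(_ isT)[K _ /(_ K (leqnn K))] /=.
set m := fine (mu (E K)) => mK.
exists K%:R => n; rewrite addrC -lerBlDr.
(* If [n * c <= K], nonnegativity of the integral is enough; otherwise [n * c - K] is positive and
   may multiply the bound on [m]. *)
have [ncK|ncK] := leP (n%:R * c) K%:R.
  have : 0 <= n%:R * e by rewrite mulr_ge0// ltW.
  by have := int0 n; lra.
have iEK : intg (\1_(E K)) by exact: integrable_indic.
have : (n%:R * c - K%:R) * m <= \int[mu]_x h n x.
  rewrite (_ : m = \int[mu]_x \1_(E K) x); last first.
    by rewrite /Rintegral integral_indic// setIT.
  rewrite -RintegralZl//; apply: le_Rintegral => //.
    exact: (integrableZl measurableT (n%:R * c - K%:R) iEK).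
  move=> x _; rewrite indicE; case: (boolP (x \in E K)) => [|_].
    by rewrite inE mulr1; exact.
  by rewrite mulr0.
have nc : n%:R * c * (e / c) = n%:R * e by field; rewrite gt_eqF.
have Kec : 0 <= K%:R * (e / c) by rewrite mulr_ge0// divr_ge0// ltW.
have m1 : 1 - e / c < m by move: mK; rewrite ltr_distlC => /andP[].
have : (n%:R * c - K%:R) * (1 - e / c) <= (n%:R * c - K%:R) * m.
  by rewrite ler_wpM2l ?subr_ge0 ?ltW.
by rewrite mulrBr mulr1 mulrBl nc; lra.
Qed.

(** The limit is the supremum of the slopes admitting a linear minorant almost everywhere. Below it
    minorants exist; above it the dichotomy provides blocks of small average. Each fact controls
    both the orbits and the integrals. *)
Theorem subadditive_ergodic_theorem h : subadditive_cocycle T h ->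
  (forall n, intg (h n)) -> (forall n x, 0 <= h n x) ->
  exists L : R,
    {ae mu, forall x, n%:R^-1 * h n x @[n --> \oo] --> L} /\
    n%:R^-1 * (\int[mu]_x h n x) @[n --> \oo] --> L.
Proof.
move=> hsub ih hpos.
have mh n := integrable_measurable (ih n).
pose S := [set c | {ae mu, forall x, linear_minorant h c x}].
have S0 : S 0.
  by apply: aeW => x; exists 0 => n; rewrite mulr0 subr0.
have Sint c : S c -> growth_ge (fun n => \int[mu]_x h n x) c.
  exact: Rintegral_growth_ge.
have hub : growth_le (fun n => \int[mu]_x h n x) (\int[mu]_x h 1%N x).
  apply: (@growth_le_bound _ _ _ 0) => n; rewrite addr0.
  rewrite -(Rintegral_bsum T_mp)//; apply: le_Rintegral => //.
    exact: (integrable_bsum T_mp).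
  move=> x _; rewrite -[leRHS]add0r -[X in X + _](mulr0 n%:R).
  by apply: (subadditive_le_bsum hsub) => y; rewrite add0r.
have supS : has_sup S.
  split; first by exists 0.
  by exists (\int[mu]_x h 1%N x) => c /Sint /growth_le_compare; exact.
have Slt c : c < sup S -> S c.
  rewrite -subr_gt0 => cS; have [b Sb] := sup_adherent cS supS.
  rewrite opprB addrCA subrr addr0 => cb.
  apply: filterS Sb => x [K hK]; exists K => n; apply: le_trans (hK n).
  by rewrite lerD2r ler_wpM2l// ltW.
have gtS c : sup S < c ->
    {ae mu, forall x, exists2 l, (0 < l)%N & h l x <= l%:R * c}.
  move=> Sc; have [Hc|//] := linear_minorant_or T_ergodic c hsub mh.
  by move: Sc; rewrite ltNge ub_le_sup//; exact: supS.2.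
have mid k : sup S - k.+1%:R^-1 < sup S.
  by rewrite ltrBlDr ltrDl invr_gt0.
have ink k : sup S < sup S + k.+1%:R^-1 by rewrite ltrDl invr_gt0.
have lo : {ae mu, forall x, growth_ge (h ^~ x) (sup S)}.
  have : {ae mu, forall x k, linear_minorant h (sup S - k.+1%:R^-1) x}.
    by apply: ae_foralln => k; exact: Slt.
  apply: filterS => x hx; apply: growth_le_inf => k.
  have := linear_minorant_growth (hx k).
  by rewrite /growth_ge opprB addrC.
have hi : {ae mu, forall x, growth_le (h ^~ x) (sup S)}.
  have : {ae mu, forall x k, growth_le (h ^~ x) (sup S + k.+1%:R^-1)}.
    by apply: ae_foralln => k; apply: ae_growth_le => //; exact: gtS.
  by apply: filterS => x; exact: growth_le_inf.
exists (sup S); split.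
  by apply: filterS2 lo hi => x xlo xhi; exact: growth_cvg.
apply: growth_cvg.
  by apply: growth_le_inf => k; apply: Rintegral_growth_le => //; exact: gtS.
apply: growth_le_inf => k; have := Sint _ (Slt _ (mid k)).
by rewrite /growth_ge opprB addrC.
Qed.

End Kingman.

(** * Jensen's formula for polynomials without zeros in the disc *)

Section Jensen.
Context {R : realType}.
Local Notation leb := (@lebesgue_measure R).
Local Notation normc := (@Normc.normc R).
Implicit Types (g h : R -> R) (z w : R[i]).

Lemma integrable_continuous_itv g (p q : R) : continuous g ->
  leb.-integrable `[p, q] (EFin \o g).
Proof.
move=> cg; apply: continuous_compact_integrable; first exact: segment_compact.
exact: continuous_subspaceT.
Qed.

Lemma Rintegral_itv_cst (r c : R) : 0 <= r ->
  \int[leb]_(t in `[0, r]) c = r * c.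
Proof.
move=> r0; have leb_r : leb `[0, r]%classic = r%:E.
  rewrite lebesgue_measure_itv/= lte_fin; case: ltP => [_|r_le0].
    by rewrite -EFinB subr0.
  by congr EFin; apply: le_anti; rewrite r0.
by rewrite Rintegral_cst// mulrC; congr (_ * _); exact: (congr1 fine leb_r).
Qed.

Lemma Rintegral_affine g (a b p q : R) : 0 < a -> p <= q -> continuous g ->
  \int[leb]_(t in `[p, q]) g (a * t + b) =
  a^-1 * \int[leb]_(t in `[a * p + b, a * q + b]) g t.
Proof.
move=> a0 pq cg; pose F (t : R) := a * t + b.
have dF (t : R) : is_derive t 1 F a.
  by rewrite /F; apply: is_derive_eq; rewrite addr0 /GRing.scale/= mulr1.
have F' : derive1 F = cst a.
  by apply/funext => t; rewrite derive1E; exact: derive_val.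
have cF : continuous F.
  by move=> t; apply: differentiable_continuous; apply/derivable1_diffP; exact: ex_derive.
have cgF : continuous (g \o F) by move=> t; apply: continuous_comp; [exact: cF|exact: cg].
rewrite {2}/Rintegral (@integration_by_substitution_increasing _ F g p q)//; first last.
- exact: continuous_subspaceT.
- split; first by move=> *; exact: ex_derive.
    by apply: cvg_at_right_filter; exact: cF.
  by apply: cvg_at_left_filter; exact: cF.
- by rewrite F'; exact: is_cvg_cst.
- by rewrite F'; exact: is_cvg_cst.
- by rewrite F' => t _; exact: cvg_cst.
- by move=> x y _ _ xy; rewrite ltrD2r ltr_pM2l.
rewrite -[fine _]/(\int[leb]_(t in `[p, q]) (((g \o F) * derive1 F) t)).
under [in RHS]eq_Rintegral do rewrite F' mulrC.
rewrite RintegralZl//; last exact: integrable_continuous_itv.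
by rewrite mulKf// gt_eqF.
Qed.

(** The half [[pi, 2 * pi]] is shifted onto [[0, pi]], where the two integrands add up to
    [h (2 * t)]; substitution then stretches [[0, pi]] to the full interval. *)
Lemma Rintegral_doubling g h : continuous g -> continuous h ->
  (forall t, g t + g (t + pi) = h (2 * t)) ->
  \int[leb]_(t in `[0, 2 * pi]) g t = 2^-1 * \int[leb]_(t in `[0, 2 * pi]) h t.
Proof.
move=> cg ch gh; have pi0 := pi_gt0 R.
have ig : leb.-integrable `[0, 2 * pi] (EFin \o g) by exact: integrable_continuous_itv.
have split_pi : \int[leb]_(t in `[0, 2 * pi]) g t =
    \int[leb]_(t in `[0, pi]) g t + \int[leb]_(t in `[pi, 2 * pi]) g t.
  have := Rintegral_itvB (x := pi) ig.
  rewrite !bnd_simp => /(_ (ltW pi0)); rewrite ler_peMl ?ler1n ?ltW//.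
  move=> /(_ isT)/eqP; rewrite subr_eq addrC => /eqP ->; congr (_ + _).
  rewrite Rintegral_itv_obnd_cbnd//.
  apply: integrableS (integrable_continuous_itv pi (2 * pi) cg) => //.
  exact: subset_itv_oc_cc.
have shift : \int[leb]_(t in `[pi, 2 * pi]) g t =
    \int[leb]_(t in `[0, pi]) g (1 * t + pi).
  rewrite Rintegral_affine ?ltW// invr1 mul1r mulr0 add0r mul1r.
  by have -> : 2 * pi = pi + pi :> R by ring.
have cgs : continuous (fun t : R => g (1 * t + pi)).
  move=> t; apply: (@continuous_comp _ _ _ (fun t : R => 1 * t + pi)); last exact: cg.
  apply: cvgD; last exact: cvg_cst.
  by apply: cvgM; [exact: cvg_cst|exact: cvg_id].
rewrite split_pi shift -RintegralD//; try exact: integrable_continuous_itv.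
under eq_Rintegral do rewrite mul1r gh -[2 * _]addr0.
by rewrite Rintegral_affine ?ltW// mulr0 !addr0.
Qed.

Definition cis (t : R) : R[i] := Complex (cos t) (sin t).

Lemma cisDpi t : cis (t + pi) = - cis t.
Proof. by rewrite /cis cosDpi sinDpi. Qed.

Lemma cis_double t : cis (2 * t) = cis t ^+ 2.
Proof.
rewrite /cis mulr_natl cos_mulr2n sin_mulr2n expr2; apply/eqP.
rewrite eq_complex /=; apply/andP; split; apply/eqP.
  by have := cos2Dsin2 t; rewrite !expr2 mulr2n => h; lra.
by rewrite mulr2n; ring.
Qed.

Lemma normc_ge0 z : 0 <= normc z.
Proof. by case: z => x y; exact: sqrtr_ge0. Qed.

Lemma normc_sqr z : normc z ^+ 2 = complex.Re z ^+ 2 + complex.Im z ^+ 2.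
Proof. by case: z => x y /=; rewrite sqr_sqrtr// addr_ge0// sqr_ge0. Qed.

Lemma normc_cis t : normc (cis t) = 1.
Proof. by rewrite /= cos2Dsin2 sqrtr1. Qed.

Lemma normc_gt0 z : (0 < normc z) = (z != 0).
Proof.
rewrite lt_def normc_ge0 andbT; congr (~~ _); apply/eqP/eqP => [|->].
  exact: Normc.eq0_normc.
exact: Normc.normc0.
Qed.

Lemma normcX z n : normc (z ^+ n) = normc z ^+ n.
Proof.
by elim: n => [|n IHn]; rewrite ?expr0 ?Normc.normc1// !exprS Normc.normcM IHn.
Qed.

Lemma normc_cisB_ge t z : normc z - 1 <= normc (cis t - z).
Proof.
rewrite lerBlDr -{1}(subrK (cis t) z) (le_trans (le_normcD _ _))//.
by rewrite normc_cis -[X in normc X]opprB normcN.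
Qed.

Lemma normc_cisB_le t z : normc (cis t - z) <= normc z + 1.
Proof.
by rewrite addrC (le_trans (le_normcD _ _))// normc_cis normcN.
Qed.

Lemma continuous_ln_normc_cis z : 1 < normc z ->
  continuous (fun t => ln (normc (cis t - z))).
Proof.
move=> z1 t; apply: continuous_comp.
  case: z {z1} => x y /=.
  apply: (@continuous_comp _ _ _
    (fun t => (cos t - x) ^+ 2 + (sin t - y) ^+ 2)); last exact: sqrt_continuous.
  apply: cvgD; apply: cvgM; apply: cvgB; try exact: cvg_cst.
  - exact: continuous_cos.
  - exact: continuous_cos.
  - exact: continuous_sin.
  - exact: continuous_sin.
by apply: continuous_ln; have := normc_cisB_ge t z; lra.
Qed.

(* Multiplying the values at [t] and [t + pi] halves the mean and squares the
   root; the defect stays bounded under iteration, hence vanishes. *)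
Lemma Rintegral_ln_normc_cis z : 1 < normc z ->
  \int[leb]_(t in `[0, 2 * pi]) ln (normc (cis t - z)) =
  2 * pi * ln (normc z).
Proof.
move=> z1; have pi0 := pi_gt0 R.
pose J w := \int[leb]_(t in `[0, 2 * pi]) ln (normc (cis t - w)).
pose D w := J w - 2 * pi * ln (normc w).
have sqr1 w : 1 < normc w -> 1 < normc (w ^+ 2).
  by move=> w1; rewrite normcX exprn_egt1.
have Dsqr w : 1 < normc w -> D (w ^+ 2) = 2 * D w.
  move=> w1; have c1 := continuous_ln_normc_cis w1.
  have c2 := continuous_ln_normc_cis (sqr1 _ w1).
  rewrite /D /J (Rintegral_doubling c1 c2) => [|t].
    by rewrite normcX lnXn ?(lt_trans ltr01)// -mulr_natl; field.
  have n1 s : 0 < normc (cis s - w) by have := normc_cisB_ge s w; lra.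
  rewrite -lnM ?posrE// -Normc.normcM cis_double cisDpi.
  by rewrite -normcN; congr (ln (normc _)); ring.
pose c := normc z.
(* Since [normc (cis t - w)] lies between [normc w - 1] and [normc w + 1], [D w] lies between
   [2 * pi] times the logarithms of [1 - (normc w)^-1] and [1 + (normc w)^-1]. For [c <= normc w],
   [B] dominates both in modulus. *)
pose B := 2 * pi * (ln (1 + c^-1) - ln (1 - c^-1)).
have Dbnd w : c <= normc w -> `|D w| <= B.
  move=> cw; have w1 : 1 < normc w := lt_le_trans z1 cw.
  have c0 : 0 < c := lt_trans ltr01 z1.
  have w0 : 0 < normc w := lt_trans ltr01 w1.
  have ii := integrable_continuous_itv 0 (2 * pi) (continuous_ln_normc_cis w1).
  have ic k : leb.-integrable `[0, 2 * pi] (EFin \o cst k).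
    by apply: integrable_continuous_itv => t; exact: cvg_cst.
  have n1 s : 0 < normc (cis s - w) by have := normc_cisB_ge s w; lra.
  have p0 : 0 <= 2 * pi :> R by rewrite mulr_ge0 ?ltW.
  have Jle : J w <= 2 * pi * ln (normc w + 1).
    rewrite /J -(Rintegral_itv_cst _ p0).
    apply: le_Rintegral _ (ii) (ic _) _ => // t _.
    by rewrite ler_ln ?posrE ?normc_cisB_le// addr_gt0.
  have Jge : 2 * pi * ln (normc w - 1) <= J w.
    rewrite /J -(Rintegral_itv_cst _ p0).
    apply: le_Rintegral _ (ic _) (ii) _ => // t _.
    by rewrite ler_ln ?posrE ?normc_cisB_ge// subr_gt0.
  have wc : (normc w)^-1 <= c^-1 by rewrite lef_pV2.
  have c1 : c^-1 < 1 by rewrite invf_lt1.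
  have wV1 : (normc w)^-1 < 1 by rewrite invf_lt1.
  have wV0 : 0 < (normc w)^-1 by rewrite invr_gt0.
  have cV0 : 0 < c^-1 by rewrite invr_gt0.
  have lw1 : ln (normc w + 1) = ln (normc w) + ln (1 + (normc w)^-1).
    rewrite -lnM ?posrE//; last exact: addr_gt0.
    by rewrite mulrDr mulr1 divff ?gt_eqF.
  have lw2 : ln (normc w - 1) = ln (normc w) + ln (1 - (normc w)^-1).
    rewrite -lnM ?posrE ?subr_gt0//.
    by rewrite mulrBr mulr1 divff ?gt_eqF.
  have l1 : ln (1 + (normc w)^-1) <= ln (1 + c^-1).
    by rewrite ler_ln ?posrE ?addr_gt0// lerD2l.
  have l2 : ln (1 - c^-1) <= ln (1 - (normc w)^-1).
    by rewrite ler_ln ?posrE ?subr_gt0// lerD2l lerN2.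
  have l3 : 0 <= ln (1 + c^-1) by rewrite ln_ge0// lerDl ltW.
  have l4 : ln (1 - c^-1) <= 0 by rewrite ln_le0// gerBl ltW.
  rewrite lw1 mulrDr in Jle; rewrite lw2 mulrDr in Jge.
  have := ler_wpM2l p0 l1; have := ler_wpM2l p0 l2.
  have := mulr_ge0 p0 l3; have := mulr_le0_ge0 l4 p0.
  by rewrite /B /D mulrBr [_ * (2 * pi)]mulrC ler_norml => *; apply/andP; split; lra.
(* Here [w] is obtained from [z] by [n] squarings, which never bring the modulus below [c] and
   double the defect each time. *)
have Diter n : `|D z| * 2 ^+ n <= B.
  have [w [w1 cw ->]] : exists w, [/\ 1 < normc w, c <= normc w & `|D z| * 2 ^+ n = `|D w|].
    elim: n => [|n [w [w1 cw IHn]]]; first by exists z; rewrite mulr1.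
    exists (w ^+ 2); split; first exact: sqr1.
      by rewrite normcX (le_trans cw)// expr2 ler_peMl ?normc_ge0// ltW.
    by rewrite Dsqr// exprSr mulrA IHn normrM normr_nat mulrC.
  exact: Dbnd.
suff : D z = 0 by move/eqP; rewrite subr_eq0 => /eqP.
apply/eqP; rewrite -normr_eq0; apply/negPn/negP => Dz.
have Dz0 : 0 < `|D z| by rewrite lt_def Dz normr_ge0.
have := Diter (Num.truncn (B / `|D z|)).+1.
rewrite leNgt => /negP; apply; rewrite mulrC -ltr_pdivrMr//.
apply: (lt_le_trans (truncnS_gt _)).
by rewrite -natrX ler_nat ltnW// ltn_expl.
Qed.

(** The polynomial splits over the complex numbers and all its roots [a] lie outside the closed
    disc. Each factor thus has mean [ln (normc a)], the value of its logarithm at 0, and the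
    logarithms add up. *)
Lemma jensen (p : {poly R[i]}) :
  (forall z, normc z <= 1 -> p.[z] != 0) ->
  continuous (fun t => ln (normc p.[cis t])) /\
  \int[leb]_(t in `[0, 2 * pi]) ln (normc p.[cis t]) =
  2 * pi * ln (normc p.[0]).
Proof.
have [r ->] := closed_field_poly_normal p.
elim: r (lead_coef p) => [|a r IHr] c p0.
  rewrite big_nil; split.
    by under eq_fun do rewrite hornerZ hornerC; move=> t; exact: cvg_cst.
  have pi0 : 0 <= 2 * pi :> R by rewrite mulr_ge0 ?ltW ?pi_gt0.
  rewrite -(Rintegral_itv_cst _ pi0); apply: eq_Rintegral => t _.
  by rewrite !hornerZ !hornerC.
set q := c *: \prod_(z <- r) ('X - z%:P) in IHr.
have pE x : (c *: \prod_(z <- a :: r) ('X - z%:P)).[x] = (x - a) * q.[x].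
  by rewrite big_cons !hornerZ hornerM hornerXsubC mulrCA.
have q0 z : normc z <= 1 -> q.[z] != 0.
  by move=> /p0; rewrite pE mulf_eq0 negb_or => /andP[].
have a1 : 1 < normc a.
  rewrite ltNge; apply/negP => /p0.
  by rewrite pE subrr mul0r eqxx.
have [cq intq] := IHr _ q0; rewrite -/q in cq intq.
have ca := continuous_ln_normc_cis a1.
have lnE : (fun t => ln (normc (c *: \prod_(z <- a :: r) ('X - z%:P)).[cis t])) =
    (fun t => ln (normc (cis t - a)) + ln (normc q.[cis t])).
  apply/funext => t; rewrite pE Normc.normcM lnM// posrE.
    by have := normc_cisB_ge t a; lra.
  by rewrite normc_gt0 q0// normc_cis.
rewrite lnE; split; first by move=> t; apply: cvgD; [exact: ca|exact: cq].
rewrite RintegralD//; try exact: integrable_continuous_itv.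
rewrite Rintegral_ln_normc_cis// intq pE sub0r -mulrDr Normc.normcM normcN.
rewrite lnM ?posrE//; first exact: lt_trans a1.
by rewrite normc_gt0 q0// Normc.normc0.
Qed.

End Jensen.

(** * Operator norms and cocycles *)

Section OperatorNorm.
Context {R : realType}.
Local Notation normc := (@Normc.normc R).
Local Notation conj := (@conjc R).
Implicit Types (M N : 'M[R]_2) (z w : R[i]).

(* Identifying the plane with the complex numbers, [M] acts as
   [z |-> mxa M * z + mxb M * conj z]. *)
Definition mxa M : R[i] :=
  Complex ((M 0 0 + M 1 1) / 2) ((M 1 0 - M 0 1) / 2).
Definition mxb M : R[i] :=
  Complex ((M 0 0 - M 1 1) / 2) ((M 1 0 + M 0 1) / 2).

Definition toC (v : 'cV[R]_2) : R[i] := Complex (v 0 0) (v 1 0).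

Lemma complex_eq (x y : R[i]) :
  complex.Re x = complex.Re y -> complex.Im x = complex.Im y -> x = y.
Proof. by case: x y => ? ? [? ?] /= -> ->. Qed.

Lemma sum_ord2 (F : 'I_2 -> R) : \sum_i F i = F 0 + F 1.
Proof.
rewrite !big_ord_recl big_ord0 addr0.
by congr (F _ + F _); apply/val_inj.
Qed.

Lemma det_mx22 M : \det M = M 0 0 * M 1 1 - M 0 1 * M 1 0.
Proof.
rewrite (expand_det_row _ 0) sum_ord2 /cofactor !det_mx11 !mxE /=.
have -> : lift 0 0 = 1 :> 'I_2 by exact/val_inj.
have -> : lift 1 0 = 0 :> 'I_2 by exact/val_inj.
by rewrite expr0 expr1; ring.
Qed.

Lemma toC_mulmx M v : toC (M *m v) = mxa M * toC v + mxb M * conj (toC v).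
Proof.
by apply: complex_eq; rewrite /= !mxE !sum_ord2; field.
Qed.

Lemma enormE (v : 'cV[R]_2) : enorm v = normc (toC v).
Proof. by rewrite /enorm sum_ord2. Qed.

Lemma mxaM M N : mxa (M *m N) = mxa M * mxa N + mxb M * conj (mxb N).
Proof.
by apply: complex_eq; rewrite /= !mxE !sum_ord2; field.
Qed.

Lemma mxbM M N : mxb (M *m N) = mxa M * mxb N + mxb M * conj (mxa N).
Proof.
by apply: complex_eq; rewrite /= !mxE !sum_ord2; field.
Qed.

Lemma mxa1 : mxa 1%:M = 1.
Proof. by apply: complex_eq; rewrite /= !mxE/=; field. Qed.

Lemma mxb1 : mxb 1%:M = 0.
Proof. by apply: complex_eq; rewrite /= !mxE/=; field. Qed.

Lemma mxa_rotmx t : mxa (rotmx t) = cis t.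
Proof. by apply: complex_eq; rewrite /= !mxE/=; field. Qed.

Lemma mxb_rotmx t : mxb (rotmx t) = 0.
Proof. by apply: complex_eq; rewrite /= !mxE/=; field. Qed.

Lemma normc_conj z : normc (conj z) = normc z.
Proof. by case: z => x y /=; rewrite sqrrN. Qed.

Lemma det_mxab M : \det M = normc (mxa M) ^+ 2 - normc (mxb M) ^+ 2.
Proof. by rewrite det_mx22 !normc_sqr /=; field. Qed.

Lemma normcD_sqr z w : normc (z + w) ^+ 2 =
  normc z ^+ 2 + normc w ^+ 2 + 2 * complex.Re (z * conj w).
Proof. by rewrite !normc_sqr; case: z w => x y [u v] /=; ring. Qed.

(** A unimodular [z] is chosen so that [a * z] and [b * conj z] have the same argument, that is,
    [a * conj b * z ^+ 2] is a nonnegative real. If [a] or [b] vanishes, [z = 1] will do. *)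
Lemma normc_aligned (a b : R[i]) :
  exists2 z, normc z = 1 & normc (a * z + b * conj z) = normc a + normc b.
Proof.
have [->|a0] := eqVneq a 0.
  exists 1; first exact: Normc.normc1.
  by rewrite mul0r add0r Normc.normcM normc_conj Normc.normc1 Normc.normc0 mulr1 add0r.
have [->|b0] := eqVneq b 0.
  exists 1; first exact: Normc.normc1.
  by rewrite mul0r addr0 Normc.normcM Normc.normc1 Normc.normc0 mulr1 addr0.
pose k := a * conj b.
have k0 : normc k != 0.
  by rewrite gt_eqF// normc_gt0 mulf_neq0// conjc_eq0.
pose z := sqrtc (conj k * ((normc k)^-1)%:C%C).
have z2 : z ^+ 2 = conj k * ((normc k)^-1)%:C%C by rewrite sqr_sqrtc.
have nC (x : R) : 0 <= x -> normc x%:C%C = x.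
  by move=> x0 /=; rewrite expr0n addr0 sqrtr_sqr ger0_norm.
have nz : normc z = 1.
  apply/eqP; rewrite -(@pexpr_eq1 _ _ 2)// ?normc_ge0// -normcX z2.
  by rewrite Normc.normcM normc_conj nC ?invr_ge0 ?normc_ge0// mulfV.
exists z => //; apply/eqP; rewrite -(@eqrXn2 _ 2)// ?normc_ge0//; last first.
  by rewrite addr_ge0 ?normc_ge0.
rewrite normcD_sqr !Normc.normcM normc_conj nz !mulr1 sqrrD.
have -> : a * z * conj (b * conj z) = (normc a * normc b)%:C%C.
  rewrite rmorphM/= conjcK mulrACA -expr2 z2 -/k mulrA.
  have -> : k * conj k = (normc k ^+ 2)%:C%C.
    rewrite normc_sqr; apply: complex_eq; case: (k) => x y /=; ring.
  rewrite -rmorphM/= expr2 mulfK//.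
  by rewrite Normc.normcM normc_conj.
by rewrite /= -mulr_natl; apply/eqP; ring.
Qed.

(** The triangle inequality gives the upper bound, and the vector from [normc_aligned] attains
    it. *)
Lemma opnormE M : opnorm M = normc (mxa M) + normc (mxb M).
Proof.
pose col z : 'cV[R]_2 := \col_i if i == 0 then complex.Re z else complex.Im z.
have colK z : toC (col z) = z by apply: complex_eq; rewrite /= mxE.
apply/eqP; rewrite eq_le; apply/andP; split; last first.
  have [z z1 <-] := normc_aligned (mxa M) (mxb M).
  apply: ub_le_sup; last first.
    by exists (col z) => /=; rewrite !enormE ?toC_mulmx colK.
  exists (normc (mxa M) + normc (mxb M)) => _ [v /= v1 <-].
  rewrite enormE toC_mulmx (le_trans (le_normcD _ _))//.
  by rewrite !Normc.normcM normc_conj -enormE v1 !mulr1.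
apply: ge_sup.
  exists (enorm (M *m col 1)), (col 1) => //=.
  by rewrite enormE colK Normc.normc1.
move=> _ [v /= v1 <-].
rewrite enormE toC_mulmx (le_trans (le_normcD _ _))//.
by rewrite !Normc.normcM normc_conj -enormE v1 !mulr1.
Qed.

Lemma opnormM M N : opnorm (M *m N) <= opnorm M * opnorm N.
Proof.
rewrite !opnormE mxaM mxbM.
have := le_normcD (mxa M * mxa N) (mxb M * conj (mxb N)).
have := le_normcD (mxa M * mxb N) (mxb M * conj (mxa N)).
by rewrite !Normc.normcM !normc_conj; lra.
Qed.

Lemma opnorm_rotmx M t : opnorm (M *m rotmx t) = opnorm M.
Proof.
rewrite !opnormE mxaM mxbM mxa_rotmx mxb_rotmx conjc0 !mulr0 addr0 add0r.
by rewrite !Normc.normcM normc_conj normc_cis !mulr1.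
Qed.

Lemma det_rotmx t : \det (rotmx t : 'M[R]_2) = 1.
Proof. by rewrite det_mx22 !mxE /= mulNr opprK -!expr2 cos2Dsin2. Qed.

Section DeterminantOne.
Context M (M1 : \det M = 1).

Lemma normc_mxa_sqr : normc (mxa M) ^+ 2 = 1 + normc (mxb M) ^+ 2.
Proof. by have := M1; rewrite det_mxab; lra. Qed.

Lemma normc_mxa_ge1 : 1 <= normc (mxa M).
Proof.
rewrite -(@ler_pXn2r _ 2) ?nnegrE ?normc_ge0// expr1n normc_mxa_sqr.
by rewrite lerDl sqr_ge0.
Qed.

Lemma normc_mxb_le : normc (mxb M) <= normc (mxa M).
Proof.
rewrite -(@ler_pXn2r _ 2) ?nnegrE ?normc_ge0// normc_mxa_sqr.
by rewrite lerDr.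
Qed.

Lemma normc_mxa_le_opnorm : normc (mxa M) <= opnorm M.
Proof. by rewrite opnormE lerDl normc_ge0. Qed.

Lemma opnorm_le_normc_mxa : opnorm M <= 2 * normc (mxa M).
Proof. by rewrite opnormE; have := normc_mxb_le; lra. Qed.

Lemma opnorm_ge1 : 1 <= opnorm M.
Proof. exact: le_trans normc_mxa_ge1 normc_mxa_le_opnorm. Qed.

(** Determinant 1 reads [(|a| + |b|) * (|a| - |b|) = 1], so the inverse of the norm is [|a| - |b|]
    and the terms in [|b|] cancel. *)
Lemma opnormDV : (opnorm M + (opnorm M)^-1) / 2 = normc (mxa M).
Proof.
have o0 : opnorm M != 0 by rewrite gt_eqF// (lt_le_trans ltr01 opnorm_ge1).
have -> : (opnorm M)^-1 = normc (mxa M) - normc (mxb M).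
  apply: (mulfI o0); rewrite mulfV// opnormE.
  by have := normc_mxa_sqr; rewrite !expr2; lra.
by rewrite opnormE; field.
Qed.

End DeterminantOne.
End OperatorNorm.

(** * Polynomials in [cis t] attached to the rotated cocycle *)

Section CocyclePolynomials.
Context {R : realType} {X : Type} (T : X -> X) (A : X -> 'M[R]_2).
Context (A_SL2 : forall x, \det (A x) = 1).
Local Notation leb := (@lebesgue_measure R).
Local Notation normc := (@Normc.normc R).
Local Notation conj := (@conjc R).
Local Arguments conjc : simpl never.

Definition rotated (t : R) (x : X) : 'M[R]_2 := A x *m rotmx t.

Lemma det_rotated t x : \det (rotated t x) = 1.
Proof. by rewrite det_mulmx A_SL2 det_rotmx mulr1. Qed.

Lemma det_cocycle (B : X -> 'M[R]_2) n x :
  (forall y, \det (B y) = 1) -> \det (cocycle T B n x) = 1.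
Proof.
by move=> B1; elim: n => [|n IHn] /=; rewrite ?det1// det_mulmx B1 IHn mulr1.
Qed.

(* [pq n x] evaluated at [cis t] is [cis t ^+ n] times the pair
   [(conj (mxa M), mxb M)] for [M := cocycle T (rotated t) n x]. *)
Fixpoint pq n x : {poly R[i]} * {poly R[i]} :=
  if n is m.+1 then
    let M := A (iter m T x) in
    let: (p, q) := pq m x in
    (conj (mxa M) *: p + conj (mxb M) *: ('X^2 * q),
     mxb M *: p + mxa M *: ('X^2 * q))
  else (1, 0).

Lemma pqE n x t : let M := cocycle T (rotated t) n x in
  (pq n x).1.[cis t] = cis t ^+ n * conj (mxa M) /\
  (pq n x).2.[cis t] = cis t ^+ n * mxb M.
Proof.
have cJ : cis t * conj (cis t) = 1.
  rewrite /cis /conjc; apply: complex_eq => /=; last by ring.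
  by rewrite mulrN opprK -!expr2 cos2Dsin2.
elim: n => [|n] /=.
  by rewrite mxa1 mxb1 rmorph1 !(hornerE, expr0, mulr1, mulr0).
case: (pq n x) => p q /= [pE qE].
rewrite !(mxaM, mxbM) mxa_rotmx mxb_rotmx conjc0 !mulr0 addr0 add0r.
rewrite !hornerE pE qE exprS !rmorphD !rmorphM /= !conjcK.
split.
  (* The intermediate expression isolates the factor [cis t * conj (cis t)], which [cJ] replaces by
     1; what remains is an identity of commutative rings. *)
  transitivity (cis t * cis t ^+ n * (conj (cis t) * cis t) * 0 +
    (cis t * conj (cis t)) * (cis t ^+ n) * (conj (mxa (A (iter n T x))) *
       conj (mxa (cocycle T (rotated t) n x))) +
     conj (mxb (A (iter n T x))) * (cis t ^+ 2 *
       (cis t ^+ n * mxb (cocycle T (rotated t) n x)))).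
    by rewrite cJ; ring.
  by ring.
transitivity ((cis t * conj (cis t)) * (cis t ^+ n) * (mxb (A (iter n T x)) *
       conj (mxa (cocycle T (rotated t) n x))) +
     mxa (A (iter n T x)) * (cis t ^+ 2 *
       (cis t ^+ n * mxb (cocycle T (rotated t) n x)))).
  by rewrite cJ; ring.
by ring.
Qed.

(** With [u = z ^+ 2 * q.[z]], one step multiplies [|p|^2 - |u|^2] by [\det M = 1]. On the disc
    [|u| <= |q|], so the gap between the two squared moduli never decreases. *)
Lemma pq_gap n x z : normc z <= 1 ->
  1 + normc (pq n x).2.[z] ^+ 2 <= normc (pq n x).1.[z] ^+ 2.
Proof.
move=> z1; elim: n => [|n] /=.
  by rewrite !hornerE Normc.normc0 Normc.normc1 expr0n addr0 expr1n.
case: (pq n x) => p q /= IHn; set M := A _.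
rewrite !hornerD !hornerZ hornerM hornerXn; set u := z ^+ 2 * q.[z].
have uq : normc u ^+ 2 <= normc q.[z] ^+ 2.
  rewrite Normc.normcM normcX exprMn ler_piMl ?sqr_ge0//.
  by rewrite -exprM exprn_ile1 ?normc_ge0.
have M1 := normc_mxa_sqr (A_SL2 (iter n T x)); rewrite -/M in M1.
have gap : normc (conj (mxa M) * p.[z] + conj (mxb M) * u) ^+ 2 -
    normc (mxb M * p.[z] + mxa M * u) ^+ 2 = normc p.[z] ^+ 2 - normc u ^+ 2.
  transitivity ((normc (mxa M) ^+ 2 - normc (mxb M) ^+ 2) *
      (normc p.[z] ^+ 2 - normc u ^+ 2)).
    rewrite /conjc !normc_sqr; move: (mxa M) (mxb M) p.[z] (u).
    by move=> [? ?] [? ?] [? ?] [? ?] /=; ring.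
  by rewrite M1 addrK mul1r.
by move: gap; lra.
Qed.

Lemma pq_neq0 n x z : normc z <= 1 -> (pq n x).1.[z] != 0.
Proof.
move=> /(pq_gap n x) h; apply/eqP => p0; move: h; rewrite p0 Normc.normc0.
by have := sqr_ge0 (normc (pq n x).2.[z]); rewrite expr0n/=; lra.
Qed.

(** The factor ['X^2] removes the second polynomial at 0, so each step multiplies the constant term
    by [conj (mxa M)]. *)
Lemma pq_at0 n x : ln (normc (pq n x).1.[0]) =
  bsum T (fun y => ln (normc (mxa (A y)))) n x.
Proof.
elim: n => [|n]; first by rewrite bsum0 /= hornerE Normc.normc1 ln1.
have a0 := lt_le_trans ltr01 (normc_mxa_ge1 (A_SL2 (iter n T x))).
have : 0 < normc (pq n x).1.[0].
  by rewrite normc_gt0 pq_neq0// Normc.normc0.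
rewrite -addn1 bsumD bsum1 addn1 /=; case: (pq n x) => p q /= p0 IHn.
rewrite !hornerD !hornerZ hornerM hornerXn expr0n mul0r mulr0 addr0.
by rewrite Normc.normcM normc_conj lnM ?posrE// IHn addrC.
Qed.

Lemma normc_mxa_cocycle n x t :
  normc (mxa (cocycle T (rotated t) n x)) = normc (pq n x).1.[cis t].
Proof.
have [-> _] := pqE n x t.
by rewrite Normc.normcM normcX normc_cis expr1n mul1r normc_conj.
Qed.

Lemma Rintegral_ln_normc_mxa_cocycle n x :
  leb.-integrable `[0, 2 * pi] (EFin \o
    (fun t => ln (normc (mxa (cocycle T (rotated t) n x))))) /\
  \int[leb]_(t in `[0, 2 * pi])
    ln (normc (mxa (cocycle T (rotated t) n x))) =
  2 * pi * bsum T (fun y => ln (normc (mxa (A y)))) n x.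
Proof.
have [cp intp] := jensen (pq_neq0 n x).
under [X in EFin \o X]eq_fun do rewrite normc_mxa_cocycle.
split; first exact: integrable_continuous_itv.
under eq_Rintegral do rewrite normc_mxa_cocycle.
by rewrite intp pq_at0.
Qed.

Definition lognorm (B : X -> 'M[R]_2) n x := ln (opnorm (cocycle T B n x)).

Lemma lognorm_ge0 B n x : (forall y, \det (B y) = 1) -> 0 <= lognorm B n x.
Proof. by move=> B1; rewrite ln_ge0// opnorm_ge1// det_cocycle. Qed.

Lemma cocycleD (B : X -> 'M[R]_2) m n x :
  cocycle T B (m + n) x = cocycle T B n (iter m T x) *m cocycle T B m x.
Proof.
elim: n => [|n IHn]; first by rewrite addn0 mul1mx.
by rewrite addnS /= IHn mulmxA addnC iterD.
Qed.

Lemma opnorm1 : opnorm (1%:M : 'M[R]_2) = 1.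
Proof. by rewrite opnormE mxa1 mxb1 Normc.normc0 Normc.normc1 addr0. Qed.

Lemma subadditive_lognorm (B : X -> 'M[R]_2) : (forall y, \det (B y) = 1) ->
  subadditive_cocycle T (lognorm B).
Proof.
move=> B1; split=> [x|m n x]; first by rewrite /lognorm /= opnorm1 ln1.
have o0 k y : 0 < opnorm (cocycle T B k y).
  by apply: lt_le_trans ltr01 _; apply: opnorm_ge1; exact: det_cocycle.
rewrite /lognorm -lnM ?posrE// ler_ln ?posrE ?mulr_gt0//.
by rewrite cocycleD mulrC opnormM.
Qed.

Lemma lognorm_rotated_bounds n x t :
  ln (normc (mxa (cocycle T (rotated t) n x))) <= lognorm (rotated t) n x <=
  ln (normc (mxa (cocycle T (rotated t) n x))) + ln 2.
Proof.
have M1 := det_cocycle n x (det_rotated t).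
have a0 := lt_le_trans ltr01 (normc_mxa_ge1 M1).
have o0 := lt_le_trans ltr01 (opnorm_ge1 M1).
rewrite /lognorm ler_ln ?posrE// normc_mxa_le_opnorm/=.
rewrite addrC -lnM ?posrE// ler_ln ?posrE ?mulr_gt0//.
exact: opnorm_le_normc_mxa.
Qed.

End CocyclePolynomials.

(** * Measurability of matrix-valued functions *)

Section Measurability.
Context {d} {Y : measurableType d} {R : realType}.
Local Notation normc := (@Normc.normc R).

(** Entrywise measurability passes directly to products and norms of matrices, also when [Y] is the
    product of the angles and the base space. *)
Definition measurable_entries (B : Y -> 'M[R]_2) :=
  forall i j, measurable_fun [set: Y] (fun y => B y i j).

Lemma borel_measurable_entries (B : Y -> 'M[R]_2) :
  borel_measurable_mx B -> measurable_entries B.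
Proof.
move=> mB i j mY.
apply: (measurability _ (RGenOInfty.measurableE R)) => //.
move=> _ [_ [a ->] <-].
suff -> : [set: Y] `&` (fun y => B y i j) @^-1` `]a, +oo[ =
    [set: Y] `&` B @^-1` [set M : 'M[R]_2 | a < M i j].
  apply: mB => //; apply: sub_sigma_algebra.
  rewrite (_ : [set M | _] = (fun M : 'M[R]_2 => M i j) @^-1` [set x | a < x]) //.
  apply: open_comp; last exact: open_gt.
  by move=> M _; exact: coord_continuous.
by apply/seteqP; split=> y /=; rewrite in_itv/= andbT.
Qed.

Lemma measurable_entriesM (B C : Y -> 'M[R]_2) :
  measurable_entries B -> measurable_entries C ->
  measurable_entries (fun y => B y *m C y).
Proof.
move=> mB mC i j; under eq_fun do rewrite mxE sum_ord2.
by apply: measurable_funD; apply: measurable_funM.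
Qed.

Lemma measurable_entries_rotmx (f : Y -> R) : measurable_fun [set: Y] f ->
  measurable_entries (fun y => rotmx (f y)).
Proof.
move=> mf i j; under eq_fun do rewrite mxE.
have mc : measurable_fun [set: Y] (fun y => cos (f y)).
  apply: measurableT_comp mf; apply: continuous_measurable_fun.
  exact: continuous_cos.
have ms : measurable_fun [set: Y] (fun y => sin (f y)).
  apply: measurableT_comp mf; apply: continuous_measurable_fun.
  exact: continuous_sin.
by case: (i == j) => //; case: (i == ord0) => //; exact: measurableT_comp ms.
Qed.

Lemma measurable_normc (f g : Y -> R) :
  measurable_fun [set: Y] f -> measurable_fun [set: Y] g ->
  measurable_fun [set: Y] (fun y => normc (Complex (f y) (g y))).
Proof.
move=> mf mg.
apply: (@measurableT_comp _ _ _ _ _ _ (@Num.sqrt R)).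
  by apply: continuous_measurable_fun; exact: sqrt_continuous.
by apply: measurable_funD; apply: measurable_funX.
Qed.

Lemma measurable_normc_mxa (B : Y -> 'M[R]_2) : measurable_entries B ->
  measurable_fun [set: Y] (fun y => normc (mxa (B y))).
Proof.
move=> mB; apply: measurable_normc; apply: measurable_funM => //.
  exact: measurable_funD.
exact: measurable_funB.
Qed.

Lemma measurable_normc_mxb (B : Y -> 'M[R]_2) : measurable_entries B ->
  measurable_fun [set: Y] (fun y => normc (mxb (B y))).
Proof.
move=> mB; apply: measurable_normc; apply: measurable_funM => //.
  exact: measurable_funB.
exact: measurable_funD.
Qed.

Lemma measurable_opnorm (B : Y -> 'M[R]_2) : measurable_entries B ->
  measurable_fun [set: Y] (fun y => opnorm (B y)).
Proof.
move=> mB; under eq_fun do rewrite opnormE.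
by apply: measurable_funD; [exact: measurable_normc_mxa|exact: measurable_normc_mxb].
Qed.

End Measurability.

(** * Averaging the rotated cocycle over the base and the angle *)

Section RotatedCocycle.
Context {d} {X : measurableType d} {R : realType} {mu : probability X R}.
Context {T : X -> X} {A : X -> 'M[R]_2}.
Context (T_ergodic : ergodic mu T) (A_SL2 : forall x, \det (A x) = 1).
Context (mA : measurable_entries A).
Context (A_log : (\int[mu]_x (ln (opnorm (A x)))%:E < +oo)%E).
Local Notation leb := (@lebesgue_measure R).
Local Notation normc := (@Normc.normc R).
Local Notation intg f := (mu.-integrable setT (EFin \o f)).
Local Notation D := `[0, 2 * @pi R]%classic.

Let T_mp : measure_preserving mu T := proj1 T_ergodic.

Let f n t x := lognorm T (rotated A t) n x.

Let f_ge0 n t x : 0 <= f n t x.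
Proof. by apply: lognorm_ge0; exact: det_rotated. Qed.

(** General [tau] and [xi] cover at once a fixed angle, a fixed base point, and joint measurability
    on [R * X]. *)
Lemma measurable_cocycle d' (Y : measurableType d') (tau : Y -> R) (xi : Y -> X) n :
  measurable_fun [set: Y] tau -> measurable_fun [set: Y] xi ->
  measurable_entries (fun y => cocycle T (rotated A (tau y)) n (xi y)).
Proof.
move=> mtau mxi; elim: n => [|n IHn] /=.
  by move=> i j; exact: measurable_cst.
apply: measurable_entriesM => //.
apply: measurable_entriesM; last exact: measurable_entries_rotmx.
move=> i j.
apply: (@measurableT_comp _ _ _ _ _ _ (fun x => A x i j)); first exact: mA.
apply: (@measurableT_comp _ _ _ _ _ _ (iter n T)) => //.
exact: (measurable_iter T_mp).
Qed.

Lemma measurable_lognorm d' (Y : measurableType d') (tau : Y -> R) (xi : Y -> X) n :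
  measurable_fun [set: Y] tau -> measurable_fun [set: Y] xi ->
  measurable_fun [set: Y] (fun y => f n (tau y) (xi y)).
Proof.
move=> mtau mxi; apply: measurableT_comp; first exact: measurable_ln.
by apply: measurable_opnorm; exact: measurable_cocycle.
Qed.

(** As [opnorm (A x) >= 1], the integrand is nonnegative, so an integral below [+oo] amounts to
    integrability. *)
Lemma integrable_ln_opnorm : intg (fun x => ln (opnorm (A x))).
Proof.
apply/integrableP; split.
  apply/measurable_EFinP; apply: measurableT_comp; first exact: measurable_ln.
  exact: measurable_opnorm.
rewrite (eq_integral (fun x => (ln (opnorm (A x)))%:E))// => x _.
by rewrite /= ger0_norm// ln_ge0// opnorm_ge1.
Qed.

(** Rotations leave the operator norm unchanged, so subadditivity gives a bound independent of [t];
    it serves as domination both in [x] and in [t]. *)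
Lemma lognorm_le_bsum n t x :
  f n t x <= bsum T (fun y => ln (opnorm (A y))) n x.
Proof.
rewrite -[leRHS]add0r -[X in X + _](mulr0 n%:R).
apply: subadditive_le_bsum; first by apply: subadditive_lognorm; exact: det_rotated.
by move=> y; rewrite /lognorm /= mulmx1 opnorm_rotmx add0r.
Qed.

Lemma integrable_lognorm n t : intg (f n t).
Proof.
apply: (le_integrable _ _ _ (integrable_bsum T_mp n integrable_ln_opnorm)) => //.
  by apply/measurable_EFinP; exact: measurable_lognorm.
move=> x _ /=; rewrite lee_fin ger0_norm//.
by apply: le_trans (ler_norm _); exact: lognorm_le_bsum.
Qed.

Let F n t := \int[mu]_x f n t x.

Lemma Rintegral_lognorm_ge0 n t : 0 <= F n t.
Proof. exact: Rintegral_ge0. Qed.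

Lemma Rintegral_lognorm_le n t :
  F n t <= n%:R * \int[mu]_x ln (opnorm (A x)).
Proof.
rewrite -(Rintegral_bsum T_mp) ?integrable_ln_opnorm//.
apply: le_Rintegral => //; first exact: integrable_lognorm.
  by apply: (integrable_bsum T_mp); exact: integrable_ln_opnorm.
by move=> x _; exact: lognorm_le_bsum.
Qed.

(** The subadditive ergodic theorem provides an exponent [L]. Two candidates for the exponent are
    limits on sets of full measure, which meet, so [xget] can only return [L]. *)
Lemma upper_lyapunov_cvg t :
  n%:R^-1 * F n t @[n --> \oo] --> upper_lyapunov mu T (rotated A t).
Proof.
have [|L [Lae Lint]] := subadditive_ergodic_theorem T_ergodic
    (subadditive_lognorm T (det_rotated A_SL2 t)) (integrable_lognorm ^~ t).
  by move=> n x; exact: f_ge0.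
suff -> : upper_lyapunov mu T (rotated A t) = L by [].
apply: xget_subset1 => // l l' hl hl'.
have mu1 : (0 < mu [set: X])%E.
  by rewrite [X in (_ < X)%E](_ : _ = 1%E) ?lte01//; exact: probability_setT.
have [x [hx hx']] := @filter_ex _ _ (ae_properfilter_algebraOfSetsType mu1) _
  (filterI hl hl').
by apply: cvg_unique hx hx'.
Qed.

Lemma measurable_Rintegral_lognorm n : measurable_fun [set: R] (F n).
Proof.
apply: (measurableT_comp (fine_measurable measurableT)).
apply: (measurable_fun_fubini_tonelli_F (m2 := mu)
  (fun p : R * X => (f n p.1 p.2)%:E)) => [|p]; last by rewrite lee_fin.
by apply/measurable_EFinP; exact: measurable_lognorm.
Qed.

Let ell x := ln (normc (mxa (A x))).

Lemma integrable_ln_normc_mxa : intg ell.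
Proof.
apply: (le_integrable _ _ _ integrable_ln_opnorm) => //.
  apply/measurable_EFinP; apply: measurableT_comp; first exact: measurable_ln.
  exact: measurable_normc_mxa.
move=> x _; rewrite /= lee_fin.
have a1 := normc_mxa_ge1 (A_SL2 x); have o1 := opnorm_ge1 (A_SL2 x).
rewrite !ger0_norm ?ln_ge0// ler_ln ?posrE ?(lt_le_trans ltr01)//.
exact: normc_mxa_le_opnorm.
Qed.

Lemma integrable_itv_bounded (g : R -> R) (c : R) :
  measurable_fun [set: R] g -> (forall t, 0 <= g t <= c) ->
  leb.-integrable D (EFin \o g).
Proof.
move=> mg g0c.
have ic : leb.-integrable D (EFin \o cst c).
  by apply: integrable_continuous_itv => t; exact: cvg_cst.
apply: (le_integrable _ _ _ ic) => //.
  by apply/measurable_EFinP; exact: measurable_funTS.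
move=> t _ /=; have /andP[g0 gc] := g0c t.
by rewrite lee_fin !ger0_norm// (le_trans g0).
Qed.

Lemma integrable_Rintegral_lognorm n : leb.-integrable D (EFin \o F n).
Proof.
apply: integrable_itv_bounded (measurable_Rintegral_lognorm n) _ => t.
by rewrite Rintegral_lognorm_ge0; exact: Rintegral_lognorm_le.
Qed.

(** The indicator extends the integrand by 0 off [D], so that Tonelli's theorem on the whole product
    applies. *)
Let g n (p : R * X) := (f n p.1 p.2 * \1_D p.1)%:E.

Let gE n p : g n p = if p.1 \in D then (f n p.1 p.2)%:E else 0%E.
Proof. by rewrite /g indicE; case: ifP => _; rewrite ?mulr1 ?mulr0. Qed.

Let g_ge0 n p : (0 <= g n p)%E.
Proof. by rewrite gE; case: ifP => // _; rewrite lee_fin. Qed.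

Let measurable_g n : measurable_fun [set: R * X] (g n).
Proof.
apply/measurable_EFinP; apply: measurable_funM; first exact: measurable_lognorm.
by apply: measurableT_comp => //; exact: measurable_indic.
Qed.

Lemma measurable_Rintegral_lognorm_itv n :
  measurable_fun [set: X] (fun x => \int[leb]_(t in D) f n t x).
Proof.
apply: (measurableT_comp (fine_measurable measurableT)).
rewrite (_ : (fun x => _) = fubini_G leb (g n)).
  exact: (measurable_fun_fubini_tonelli_G (m1 := leb) (g n) (measurable_g n) (g_ge0 n)).
apply/funext => x; rewrite integral_mkcond.
by apply: eq_integral => t _; rewrite patchE gE.
Qed.

Lemma fubini_lognorm n :
  (\int[leb]_(t in D) (F n t)%:E =
   \int[mu]_x \int[leb]_(t in D) (f n t x)%:E)%E.
Proof.
have := fubini_tonelli (m1 := leb) (m2 := mu) (g n) (measurable_g n) (g_ge0 n).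
under eq_integral => t _.
  under eq_integral do rewrite gE /=.
  over.
under [X in _ = X -> _]eq_integral => x _.
  under eq_integral do rewrite gE /=.
  over.
move=> /= fub; rewrite integral_mkcond; transitivity
  (\int[leb]_t \int[mu]_x (if t \in D then (f n t x)%:E else 0%E))%E.
  apply: eq_integral => t _; rewrite patchE; case: ifP => _; last by rewrite integral0.
  by rewrite /F /Rintegral fineK//; exact: integrable_fin_num (integrable_lognorm n t).
rewrite fub; apply: eq_integral => x _; rewrite [RHS]integral_mkcond.
by apply: eq_integral => t _; rewrite patchE.
Qed.

(** For fixed [x] Jensen's formula gives the integral over [t] up to [2 * pi * ln 2]; Tonelli's
    theorem and the invariance of [mu] then give the integral over [x]. The error does not depend on
    [n]. *)
Lemma Rintegral_Rintegral_lognorm_bounds n :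
  n%:R * (2 * pi * \int[mu]_x ell x) <= \int[leb]_(t in D) F n t <=
  n%:R * (2 * pi * \int[mu]_x ell x) + 2 * pi * ln 2.
Proof.
have bi := integrable_bsum T_mp n integrable_ln_normc_mxa.
have p0 : 0 <= 2 * pi :> R by rewrite mulr_ge0 ?ltW ?pi_gt0.
have le2 : 0 <= ln 2 :> R by rewrite ln_ge0// ler1n.
have ell0 x : 0 <= bsum T ell n x.
  by apply: bsum_ge0 => y; rewrite ln_ge0// normc_mxa_ge1.
have mf x : measurable_fun [set: R] (fun t => f n t x).
  by apply: measurable_lognorm => //; exact: measurable_cst.
have if_ x : leb.-integrable D (EFin \o (fun t => f n t x)).
  apply: integrable_itv_bounded (mf x) _ => t.
  by rewrite f_ge0; exact: lognorm_le_bsum.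
pose G x := \int[leb]_(t in D) f n t x.
have GE x : (\int[leb]_(t in D) (f n t x)%:E = (G x)%:E)%E.
  by rewrite /G /Rintegral fineK//; exact: integrable_fin_num (if_ x).
have G_bounds x : 2 * pi * bsum T ell n x <= G x <=
    2 * pi * bsum T ell n x + 2 * pi * ln 2.
  have [ia inta] := Rintegral_ln_normc_mxa_cocycle T A_SL2 n x.
  rewrite -inta -(Rintegral_itv_cst _ p0) -RintegralD//; last first.
    by apply: integrable_continuous_itv => t; exact: cvg_cst.
  apply/andP; split; apply: le_Rintegral => //.
  - by move=> t _; have /andP[] := lognorm_rotated_bounds T A_SL2 n x t.
  - rewrite (_ : _ \o _ = (EFin \o (fun t => ln (normc (mxa (cocycle T (rotated A t) n x)))))
      \+ (EFin \o cst (ln 2)%R))%E//.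
    apply: integrableD => //.
    by apply: integrable_continuous_itv => t; exact: cvg_cst.
  - by move=> t _; have /andP[] := lognorm_rotated_bounds T A_SL2 n x t.
have mG : measurable_fun [set: X] G.
  exact: measurable_Rintegral_lognorm_itv.
have ilo : intg (fun x => 2 * pi * bsum T ell n x).
  exact: (integrableZl measurableT (2 * pi) bi).
have ihi : intg (fun x => 2 * pi * bsum T ell n x + 2 * pi * ln 2).
  rewrite (_ : _ \o _ = (EFin \o (fun x => 2 * pi * bsum T ell n x)%R)
    \+ (EFin \o cst (2 * pi * ln 2)%R))%E//.
  by apply: integrableD => //; exact: finite_measure_integrable_cst.
have iG : intg G.
  apply: (le_integrable _ _ _ ihi) => //; first exact/measurable_EFinP.
  move=> x _; have /andP[Glo Ghi] := G_bounds x.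
  have lo0 : 0 <= 2 * pi * bsum T ell n x by rewrite mulr_ge0.
  by rewrite /= lee_fin !ger0_norm ?(le_trans lo0)// (le_trans _ Ghi)// (le_trans lo0).
have -> : \int[leb]_(t in D) F n t = \int[mu]_x G x.
  congr fine; rewrite fubini_lognorm.
  by apply: eq_integral => x _; exact: GE.
rewrite mulrCA -(Rintegral_bsum T_mp) ?integrable_ln_normc_mxa//.
rewrite -RintegralZl// -[2 * pi * ln 2](Rintegral_prob_cst (mu := mu)).
rewrite -RintegralD//; last exact: finite_measure_integrable_cst.
by apply/andP; split; apply: le_Rintegral => // x _; have /andP[] := G_bounds x.
Qed.

(** The functions [n%:R^-1 * F n t] lie between 0 and the constant [C], so dominated convergence
    applies; their pointwise limit is measurable, and the preceding bounds identify the limit of the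
    integrals. *)
Lemma Rintegral_upper_lyapunov :
  leb.-integrable D (EFin \o (fun t => upper_lyapunov mu T (rotated A t))) /\
  \int[leb]_(t in D) upper_lyapunov mu T (rotated A t) =
  2 * pi * \int[mu]_x ell x.
Proof.
set C := \int[mu]_x ln (opnorm (A x)).
have C0 : 0 <= C.
  by apply: Rintegral_ge0 => x _; rewrite ln_ge0// opnorm_ge1.
have mF n : measurable_fun [set: R] (fun t => n%:R^-1 * F n t).
  by apply: measurable_funM => //; exact: measurable_Rintegral_lognorm.
have ic : leb.-integrable D (EFin \o cst C).
  by apply: integrable_continuous_itv => t; exact: cvg_cst.
have [//| | | | | il cvgl] := Rintegral_dominated_cvg (mu := leb) (D := D)
  (F := fun n t => n%:R^-1 * F n t)
  (f := fun t => upper_lyapunov mu T (rotated A t)) _ _ _ _ ic _.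
- by move=> n; apply: measurable_funTS; exact: mF.
- apply: measurable_funTS; apply: (measurable_fun_cvg (h := fun n t => n%:R^-1 * F n t)) => // t _.
  exact: upper_lyapunov_cvg.
- by apply: aeW => t _; exact: upper_lyapunov_cvg.
- move=> n t _; rewrite ger0_norm; last first.
    by rewrite mulr_ge0 ?invr_ge0 ?Rintegral_lognorm_ge0.
  (* At [n = 0] the inverse is 0 by convention, so the bound by [C] still holds. *)
  have [->|n0] := posnP n; first by rewrite invr0 mul0r.
  by rewrite ler_pdivrMl ?ltr0n// Rintegral_lognorm_le.
have cvgF : n%:R^-1 * (\int[leb]_(t in D) F n t) @[n --> \oo] -->
    2 * pi * \int[mu]_x ell x.
  apply: growth_cvg.
    apply: (@growth_le_bound _ _ _ (2 * pi * ln 2)) => n.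
    by have /andP[] := Rintegral_Rintegral_lognorm_bounds n.
  apply: (@growth_le_bound _ _ _ 0) => n; rewrite addr0 mulrN lerN2.
  by have /andP[] := Rintegral_Rintegral_lognorm_bounds n.
have intE n : \int[leb]_(t in D) (n%:R^-1 * F n t) =
    n%:R^-1 * \int[leb]_(t in D) F n t.
  have mD : measurable (D : set (measurableTypeR R)) by exact: measurable_itv.
  exact: (RintegralZl _ mD (integrable_Rintegral_lognorm n)).
rewrite (eq_cvg _ _ intE) in cvgl.
split=> //; exact: (cvg_unique _ cvgl cvgF).
Qed.

End RotatedCocycle.

Theorem theorem12 (R : realType) (d : measure_display) (X : measurableType d)
    (mu : probability X R) (T : X -> X) (A : X -> 'M[R]_2)
    (T_ergodic : ergodic mu T)
    (A_SL2 : forall x : X, \det (A x) = 1)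
    (A_measurable : borel_measurable_mx A)
    (A_log_integrable : (\int[mu]_x (ln (opnorm (A x)))%:E < +oo)%E) :
  (((2 * pi)^-1)%:E *
     \int[@lebesgue_measure R]_(theta in `[0%R, (2 * pi)%R])
        (upper_lyapunov mu T (fun x => A x *m rotmx theta))%:E =
   \int[mu]_x (ln ((opnorm (A x) + (opnorm (A x))^-1) / 2))%:E)%E.
Proof.
have mA := borel_measurable_entries A_measurable.
have [il intl] := Rintegral_upper_lyapunov T_ergodic A_SL2 mA A_log_integrable.
have iell := integrable_ln_normc_mxa A_SL2 mA A_log_integrable.
under [RHS]eq_integral do rewrite opnormDV//.
(* Both integrands are integrable, so both integrals are finite and the identity reduces to one
   between real numbers. *)
rewrite -[RHS]fineK; last exact: integrable_fin_num iell.
rewrite -[X in (_ * X)%E]fineK; last exact: integrable_fin_num il.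
rewrite -EFinM; congr EFin.
rewrite -[fine _]/(\int[lebesgue_measure]_(t in `[0, 2 * pi])
  upper_lyapunov mu T (rotated A t)) intl.
rewrite mulKf// mulf_neq0// gt_eqF ?pi_gt0//.
Qed.
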